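(* In the large economy and diffusion setting described in the context, under quadratic utilities, symmetric priors, and truth-telling ($m_i=y_i$ for all agents $i$), the mechanism that maximizes expected welfare given the noisy macro signal $x_t$ implements $$d^\star(x_t)=\mathbb E[x_0\mid x_t],$$ which corresponds exactly to the diffusion model's optimal denoiser $\epsilon^\star$ via $$d^\star(x_t)=\frac{1}{\alpha_t}\bigl(x_t-\sigma_t\,\epsilon^\star(x_t,t)\bigr).$$ Thus the reverse-diffusion update direction is the welfare-maximizing aggregator of noisy private information in a large economy.
   Context: Economy. There is a continuum of agents indexed by $i\in[0,1]$ and a hidden state $x_0\in\mathbb R^d$. Each agent observes a signal $y_i=x_0+\eta_i$, $\eta_i\sim\mathcal N(0,\sigma^2 I)$, independently across $i$. A principal chooses a public decision $d\in\mathbb R^d$. Each agent has the quadratic utility $u_i(d,x_0)=-\|d-x_0\|^2$, and social welfare is $W(d,x_0)=\int_0^1 u_i(d,x_0)\,di=-\|d-x_0\|^2$. In a direct mechanism each agent reports $m_i$ and the principal uses an outcome rule $d=g(m_{[0,1]})=\phi\bigl(\int_0^1 m_i\,di\bigr)$. Truth-telling means $m_i=y_i$; with a continuum of agents and a linear rule $d=A\int_0^1 m_i\,di$, truth-telling is a Bayesian Nash equilibrium (each agent has negligible influence on the integral and is indifferent among reports, with favorable tie-breaking). The phrase ''symmetric priors'' is used as a hypothesis without further definition. Macro signal and welfare problem. The principal observes a noisy macro signal $x_t=\alpha_t x_0+\sigma_t\varepsilon$, generated as in the diffusion forward process below, and her welfare problem is $\max_d\,-\mathbb E\|x_0-d\|^2$,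 where the decision is based on $x_t$. Diffusion. $x_0\in\mathbb R^d$ is drawn from an unknown distribution $p_{\mathrm{data}}$. The (variance-preserving) forward noising process is $x_t=\alpha_t x_0+\sigma_t\varepsilon$ with $\varepsilon\sim\mathcal N(0,I_d)$, $t\in[0,1]$, $\alpha_0=1$, $\sigma_0=0$, $\alpha_1\approx 0$, $\sigma_1\approx 1$. A denoising network $\epsilon_\theta(x_t,t)$ is trained with the loss $\mathcal L(\theta)=\mathbb E_{t,x_0,\varepsilon}\|\varepsilon-\epsilon_\theta(\alpha_t x_0+\sigma_t\varepsilon,t)\|^2$; the optimal denoiser $\epsilon^\star$ is its unique minimizer, $\epsilon^\star(x_t,t)=\mathbb E[\varepsilon\mid x_t]$. *)

(* Defs.v *)
From HB Require Import structures.
From mathcomp Require Import all_boot all_order all_algebra.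
From mathcomp Require Import all_classical all_reals all_analysis.

Set Implicit Arguments.
Unset Strict Implicit.
Unset Printing Implicit Defensive.

Import Order.TTheory GRing.Theory Num.Theory.
Import numFieldNormedType.Exports.

Local Open Scope classical_set_scope.
Local Open Scope ring_scope.

(* R^n is 'rV[R]_n with the sigma-algebra generated by the coordinates (the
   Borel one, for T := R); same construction as the library's for n.-tuple T. *)
Definition measure_rV_display : measure_display -> measure_display.
Proof. exact. Qed.

Section measurable_rV.
Context {d} {T : measurableType d} (n : nat).

Let coords : 'I_n -> 'rV[T]_n -> T := fun j x => x ord0 j.

Let rV_set0 : g_sigma_preimage coords set0.
Proof. exact: sigma_algebra0. Qed.

Let rV_setC A : g_sigma_preimage coords A -> g_sigma_preimage coords (~` A).
Proof. exact: sigma_algebraC. Qed.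

Let rV_bigcup (F : (set 'rV[T]_n)^nat) :
  (forall i, g_sigma_preimage coords (F i)) ->
  g_sigma_preimage coords (\bigcup_i (F i)).
Proof. exact: sigma_algebra_bigcup. Qed.

HB.instance Definition _ := @isMeasurable.Build (measure_rV_display d)
  'rV[T]_n (g_sigma_preimage coords) rV_set0 rV_setC rV_bigcup.

End measurable_rV.

(* The squared Euclidean norm; the library norm `|x| on 'rV[R]_n is the sup
   norm. *)
Definition sqnorm (R : realType) (n : nat) (x : 'rV[R]_n) : R :=
  \sum_(j < n) x ord0 j ^+ 2.

Section probability_notions.
Context {R : realType} {d : measure_display} {Omega : measurableType d}.
Variable P : probability Omega R.

Definition mutually_independent {d'} {T : measurableType d'} {I : choiceType}
    (D : set I) (X : I -> Omega -> T) : Prop :=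
  forall (s : seq I) (A : I -> set T),
    uniq s -> (forall i, i \in s -> D i) ->
    (forall i, i \in s -> measurable (A i)) ->
    P [set w | forall i, i \in s -> A i (X i w)]
      = (\prod_(i <- s) P (X i @^-1` A i))%E.

Context {n : nat}.
Implicit Types X Y M : Omega -> 'rV[R]_n.

(* X has law N(0, s^2 I): the product of n copies of N(0, s^2). To be used
   with 0 < s: normal_prob 0 s is not the Dirac mass at 0 when s = 0. *)
Definition centered_gaussian (s : R) X : Prop :=
  forall A : 'I_n -> set R, (forall j, measurable (A j)) ->
    P [set w | forall j, A j (X w ord0 j)]
      = (\prod_(j < n) normal_prob 0 s (A j))%E.

Definition integrable_vector X : Prop :=
  forall j, P.-integrable setT (EFin \o (fun w => X w ord0 j)).

(* f(Y) is a version of E[X | Y], i.e. E[X | Y = y] = f y. *)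
Definition is_cond_exp X Y (f : 'rV[R]_n -> 'rV[R]_n) : Prop :=
  [/\ measurable_fun setT f, integrable_vector (f \o Y) &
      forall (B : set 'rV[R]_n) (j : 'I_n), measurable B ->
        (\int[P]_(w in Y @^-1` B) (f (Y w) ord0 j)%:E
         = \int[P]_(w in Y @^-1` B) (X w ord0 j)%:E)%E].

(* M is the weak (Pettis) integral of i |-> m i over [0, 1] in L^1(P; R^n):
   E[M_j Z] = int_0^1 E[(m i)_j Z] di for every bounded random variable Z.
   A pathwise integral int_0^1 m i w di is not available: the sample paths of
   a continuum of independent noises are not measurable in i in general. *)
Definition population_integral (m : R -> Omega -> 'rV[R]_n) M : Prop :=
  [/\ forall i, 0 <= i <= 1 -> integrable_vector (m i),
      integrable_vector M &
      forall (j : 'I_n) (Z : {RV P >-> R}),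
        (exists C : R, forall w, `|Z w| <= C) ->
        lebesgue_measure.-integrable `[(0 : R), 1]%classic
          (EFin \o (fun i : R => \int[P]_w (m i w ord0 j * Z w))) /\
        \int[P]_w (M w ord0 j * Z w) =
          \int[lebesgue_measure]_(i in `[0, 1])
            (\int[P]_w (m i w ord0 j * Z w))].

End probability_notions.

Section economy.
Context {R : realType} {n : nat} {d : measure_display}.
Context {Omega : measurableType d}.
Variable P : probability Omega R.

Definition utility (i : R) (a x : 'rV[R]_n) : R := - sqnorm (a - x).

Definition welfare (a x : 'rV[R]_n) : R :=
  \int[lebesgue_measure]_(i in `[0, 1]) utility i a x.

(* Valued in \bar R: it is -oo when the loss is not integrable. *)
Definition expected_welfare (D x0 : Omega -> 'rV[R]_n) : \bar R :=
  (\int[P]_w (welfare (D w) (x0 w))%:E)%E.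

(* The outcome rule phi solves max_d - E||x0 - d||^2 over all decisions d
   based on the macro signal X. *)
Definition welfare_maximizing (x0 X : Omega -> 'rV[R]_n)
    (phi : 'rV[R]_n -> 'rV[R]_n) : Prop :=
  measurable_fun setT phi /\
  forall psi : 'rV[R]_n -> 'rV[R]_n, measurable_fun setT psi ->
    (expected_welfare (psi \o X) x0 <= expected_welfare (phi \o X) x0)%E.

Record private_signals (s : R) (x0 : Omega -> 'rV[R]_n)
    (eta y : R -> Omega -> 'rV[R]_n) : Prop := {
  signalE : forall i w, 0 <= i <= 1 -> y i w = x0 w + eta i w ;
  noise_law : forall i, 0 <= i <= 1 -> centered_gaussian P s (eta i) ;
  (* the state (index None) and the noises of all agents (indices Some i) *)
  noise_indep : mutually_independent P
    [set o : option R | if o is Some i then 0 <= i <= 1 else True]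
    (fun o => if o is Some i then eta i else x0)
}.

(* Agents share the common prior P, under which state and own signal have the
   same joint law for every agent. *)
Definition symmetric_priors (x0 : Omega -> 'rV[R]_n)
    (y : R -> Omega -> 'rV[R]_n) : Prop :=
  forall i k : R, 0 <= i <= 1 -> 0 <= k <= 1 ->
  forall A : set ('rV[R]_n * 'rV[R]_n), measurable A ->
    P [set w | A (x0 w, y i w)] = P [set w | A (x0 w, y k w)].

Definition truth_telling (y m : R -> Omega -> 'rV[R]_n) : Prop :=
  forall i w, 0 <= i <= 1 -> m i w = y i w.

End economy.

Section diffusion.
Context {R : realType} {n : nat} {d : measure_display}.
Context {Omega : measurableType d}.
Variables (P : probability Omega R) (alpha sigma : R -> R).

Record vp_schedule : Prop := {
  alpha_measurable : measurable_fun `[(0 : R), 1]%classic alpha ;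
  sigma_measurable : measurable_fun `[(0 : R), 1]%classic sigma ;
  alpha_start : alpha 0 = 1 ;
  sigma_start : sigma 0 = 0 ;
  variance_preserving : forall t, 0 <= t <= 1 -> alpha t ^+ 2 + sigma t ^+ 2 = 1
}.

(* The forward process started from x0. Started from the aggregate report
   int_0^1 m_i di, it is the macro signal generated by the reports. *)
Definition noised (x0 eps : Omega -> 'rV[R]_n) (t : R) (w : Omega) : 'rV[R]_n :=
  alpha t *: x0 w + sigma t *: eps w.

(* The time t has law nu and is drawn independently of (x0, eps). *)
Definition denoising_loss (nu : probability R R) (x0 eps : Omega -> 'rV[R]_n)
    (e : 'rV[R]_n -> R -> 'rV[R]_n) : \bar R :=
  (\int[nu]_(t in `[0%R, 1%R])
     \int[P]_w (sqnorm (eps w - e (noised x0 eps t w) t))%:E)%E.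

Definition optimal_denoiser (nu : probability R R)
    (x0 eps : Omega -> 'rV[R]_n) (e : 'rV[R]_n -> R -> 'rV[R]_n) : Prop :=
  measurable_fun setT (fun z : 'rV[R]_n * R => e z.1 z.2) /\
  forall e' : 'rV[R]_n -> R -> 'rV[R]_n,
    measurable_fun setT (fun z : 'rV[R]_n * R => e' z.1 z.2) ->
    (denoising_loss nu x0 eps e <= denoising_loss nu x0 eps e')%E.

(* The denoised sample (x - sigma_t eps(x, t)) / alpha_t, toward which the
   reverse-diffusion update moves. *)
Definition reverse_estimate (e : 'rV[R]_n -> R -> 'rV[R]_n) (t : R)
    (x : 'rV[R]_n) : 'rV[R]_n :=
  (alpha t)^-1 *: (x - sigma t *: e x t).

End diffusion.

(* Main.v *)
Require Import Defs.
From HB Require Import structures.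
From mathcomp Require Import all_boot all_order all_algebra.
From mathcomp Require Import all_classical all_reals all_analysis.
From mathcomp Require Import finmap measurable_realfun ring lra.
Import Order.TTheory GRing.Theory Num.Theory.
Import numFieldNormedType.Exports.
Local Open Scope classical_set_scope.
Local Open Scope ring_scope.

(* Conditional expectations given [X] are the minimizers of the square loss
   over functions of [X]: this needs no square integrability of the target,
   only that some function of [X] has finite loss. Since
   [x_t = alpha_t x_0 + sigma_t eps], estimating [x_0] from [x_t] amounts to
   estimating the square integrable [eps], which gives the denoising formula.
   The denoising loss is the square loss of [eps] given [(x_t, t)] on the
   product of the time axis and the sample space; its minimizers are
   conditional expectations at almost every time because the sigma-algebra of
   R^n is countably generated. Finally, the average report is [x_0]: the noises
   are orthogonal in L^2, so by Bessel's inequality a bounded random variable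
   is correlated with only countably many of them. *)

Set Implicit Arguments.
Unset Strict Implicit.
Unset Printing Implicit Defensive.

(** * Conditional expectation and square loss *)

(** This is why residuals are tested on preimages, then against bounded functions, and why unbounded
    comparisons go through clipping or truncation. That minimizers are conditional expectations
    would fail if all losses were infinite; the rule [x / alpha_t] excludes this, since its error is
    a multiple of [eps]. The observation ranges over an arbitrary measurable space so that the same
    lemmas serve [x_t] at a fixed time and [(x_t, t)] under [nu \x P]. In the second case each test
    set yields its own null set of times, and these must be merged into one, hence a countable
    family of test sets. On the economic side no sample path is integrated over the agents: the
    exceptional agents may depend on the test variable. *)

Lemma measurable_preimageT {d d' : measure_display} {T : measurableType d}
    {U : measurableType d'} (X : T -> U) (B : set U) :
  measurable_fun setT X -> measurable B -> measurable (X @^-1` B).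
Proof. by move=> mX mB; rewrite -[X in measurable X]setTI; exact: mX. Qed.

Section measurability.
Context {d0 : measure_display} {U : measurableType d0} {n : nat}.

Lemma measurable_coord {d} {T : measurableType d} (j : 'I_n) :
  measurable_fun [set: 'rV[T]_n] (fun x => x ord0 j).
Proof.
move=> _ Y mY; rewrite setTI; apply: sub_sigma_algebra => /=.
rewrite -bigcup_seq/=; exists j => /=; first by rewrite mem_index_enum.
by exists Y => //; rewrite setTI.
Qed.

Lemma measurable_rVP {d} {T : measurableType d} (f : U -> 'rV[T]_n) :
  measurable_fun setT f <-> forall j, measurable_fun setT (fun t => f t ord0 j).
Proof.
split=> [mf j|mf].
  exact: (measurableT_comp (measurable_coord j) mf).
have : g_sigma_preimage (fun j t => f t ord0 j) `<=` @measurable _ U.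
  apply: smallest_sub; first exact: sigma_algebra_measurable.
  by rewrite -bigcup_seq/= => A [j _ [B mB <-]]; exact: mf.
have -> : (fun (j : 'I_n) t => f t ord0 j)
    = (fun j => (fun x : 'rV[T]_n => x ord0 j) \o f) by [].
move=> sub _ A mA; apply: sub.
by rewrite g_sigma_preimage_comp; exists A.
Qed.

End measurability.

Lemma measurable_rVD {R : realType} {n : nat} {d : measure_display}
    {T : measurableType d} (f g : T -> 'rV[R]_n) :
  measurable_fun setT f -> measurable_fun setT g ->
  measurable_fun setT (fun w => f w + g w).
Proof.
move=> /measurable_rVP mf /measurable_rVP mg; apply/measurable_rVP => j.
by under eq_fun do rewrite mxE; exact: measurable_funD.
Qed.

Lemma measurable_rVZ {R : realType} {n : nat} {d : measure_display}
    {T : measurableType d} (k : T -> R)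
    (f : T -> 'rV[R]_n) :
  measurable_fun setT k -> measurable_fun setT f ->
  measurable_fun setT (fun w => k w *: f w).
Proof.
move=> mk /measurable_rVP mf; apply/measurable_rVP => j.
by under eq_fun do rewrite mxE; exact: measurable_funM.
Qed.

Lemma measurable_sqnorm {R : realType} {n : nat} {d : measure_display}
    {T : measurableType d} (f : T -> 'rV[R]_n) :
  measurable_fun setT f -> measurable_fun setT (fun w => (sqnorm (f w))%:E).
Proof.
move=> mf; apply/measurable_EFinP/measurable_sum => j.
exact/measurable_funX/((measurable_rVP f).1 mf j).
Qed.

Lemma integral_mul_indic {d} {T : measurableType d} {R : realType}
    (mu : {measure set T -> \bar R}) (A : set T) (f : T -> R) :
  (\int[mu]_x (f x * \1_A x)%:E = \int[mu]_(x in A) (f x)%:E)%E.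
Proof.
rewrite [RHS]integral_mkcond; apply: eq_integral => x _.
by rewrite patchE indicE; case: (x \in A); rewrite ?mulr1 ?mulr0.
Qed.

(** * Residuals with vanishing conditional expectation *)

Section conditionally_centered.
Context {R : realType} {d d' : measure_display}.
Context {Omega : measurableType d} {T : measurableType d'}.
Variables (P : probability Omega R) (X : Omega -> T).
Hypothesis mX : measurable_fun setT X.

(** This is E[D | X] = 0, stated without choosing a version. It is linear in [D], so it passes
    through affine changes of the estimated variable. *)
Definition conditionally_centered (D : Omega -> R) : Prop :=
  P.-integrable setT (EFin \o D) /\
  forall B, measurable B -> (\int[P]_(w in X @^-1` B) (D w)%:E = 0)%E.

Let mpre (B : set T) : measurable B -> measurable (X @^-1` B).
Proof. exact: measurable_preimageT. Qed.

(** The signed measure with density [Z], pushed forward along [X], is absolutely continuous with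
    respect to the law of [X]; [g] is its Radon-Nikodym derivative. Differentiating on [T] rather
    than on the sample space gives a function of the observation at once, with no factorization
    through [X]. *)
Lemma exists_cond_exp (Z : Omega -> R) : P.-integrable setT (EFin \o Z) ->
  exists g : T -> R, [/\ measurable_fun setT g,
    P.-integrable setT (EFin \o (g \o X)) &
    forall B, measurable B -> (\int[P]_(w in X @^-1` B) (g (X w))%:E
      = \int[P]_(w in X @^-1` B) (Z w)%:E)%E].
Proof.
move=> iZ.
pose X' : {RV P >-> T} := HB.pack X (isMeasurableFun.Build _ _ _ _ X mX).
pose nu' : {charge set T -> \bar R} := pushforward (induced_charge iZ) X'.
pose nu := nu' mX.
have nudom : nu `<< distribution P X'.
  apply/null_content_dominatesP => A mA PA0.
  rewrite /nu/= /pushforward/= /induced_charge.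
  apply: null_set_integral => //; first exact: mpre.
  have miZ := measurable_int P iZ.
  exact: (measurable_funTS miZ).
pose g0 := Radon_Nikodym nu (distribution P X').
have fg0 x : g0 x \is a fin_num by exact: Radon_Nikodym_fin_num.
have ig0 : (distribution P X').-integrable setT g0.
  exact: Radon_Nikodym_integrable.
have mg0 : measurable_fun setT g0 by exact: measurable_int ig0.
have igX : P.-integrable setT (g0 \o X).
  apply/integrableP; split; first exact: measurableT_comp.
  have /integrableP[_] := ig0.
  by rewrite ge0_integral_distribution//; exact: measurableT_comp.
exists (fine \o g0); split.
- exact: measurableT_comp.
- have -> // : EFin \o ((fine \o g0) \o X) = g0 \o X.
  by apply/funext => w /=; rewrite fineK.
- move=> B mB.
  have -> : (\int[P]_(w in X @^-1` B) (Z w)%:E = nu B)%E by [].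
  rewrite (Radon_Nikodym_integral nudom mB) -/g0.
  rewrite [RHS](_ : _ = \int[pushforward P X]_(x in B) g0 x)%E//.
  rewrite integral_pushforward//.
    by apply: eq_integral => w _ /=; rewrite fineK.
  by apply: integrableS igX => //; exact: mpre.
Qed.

Lemma integral_bounded_mul (D h : Omega -> R) (C : R) :
  P.-integrable setT (EFin \o D) -> measurable_fun setT h ->
  (forall w, `|h w| <= C) -> P.-integrable setT (fun w => (D w * h w)%:E).
Proof.
move=> iD mh hC.
have -> : (fun w => (D w * h w)%:E) = ((EFin \o D) \* (EFin \o h))%E by [].
apply: integrableMl => //.
by exists C; split; [exact: num_real|move=> M CM w _ /=;
  apply: le_trans (ltW CM)].
Qed.

Import HBNNSimple.

Let centered_nnsfun (D : Omega -> R) (h : {nnsfun T >-> R}) :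
  conditionally_centered D -> (\int[P]_w (D w * h (X w))%:E = 0)%E.
Proof.
move=> [iD cD].
have Dind r w : D w * (r * \1_(h @^-1` [set r]) (X w)) =
    r * (D w * \1_(X @^-1` (h @^-1` [set r])) w) by rewrite mulrCA !indicE.
have mr r : measurable (X @^-1` (h @^-1` [set r])) by exact: mpre.
have iDr r : P.-integrable setT
    (EFin \o (fun w => D w * \1_(X @^-1` (h @^-1` [set r])) w)).
  apply: (integral_bounded_mul (C := 1)) => // w.
  by rewrite indicE; case: (_ \in _); rewrite ?normr1// normr0.
transitivity (\int[P]_w \sum_(i < #|`fset_set (range h)|)
   ((fset_set (range h))`_i * (D w *
      \1_(X @^-1` (h @^-1` [set (fset_set (range h))`_i])) w))%:E)%E.
  apply: eq_integral => w _; rewrite fimfunEord mulr_sumr sumEFin.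
  by congr EFin; apply: eq_bigr => i _; rewrite Dind.
rewrite integral_sum//; last first.
  by move=> i; exact: (integrableZl measurableT _ (iDr _)).
apply: big1 => i _.
under eq_integral do rewrite EFinM.
rewrite integralZl//; last exact: iDr.
by rewrite (integral_mul_indic _ _ D) cD ?mule0.
Qed.

Lemma conditionally_centered_bounded (D : Omega -> R) (h : T -> R) (C : R) :
  conditionally_centered D -> measurable_fun setT h ->
  (forall x, `|h x| <= C) -> (\int[P]_w (D w * h (X w))%:E = 0)%E.
Proof.
move=> cD mh hC; have [iD cD0] := cD.
(* Constants integrate to 0 against [D], so adding [C] to [h] changes nothing; simple functions then
   approximate [h] from below, with the domination [|D| * C]. *)
wlog h0 : h C mh hC / forall x, 0 <= h x => [wlg|].
  have D0 : (\int[P]_w (D w * C)%:E = 0)%E.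
    under eq_integral do rewrite mulrC EFinM.
    by rewrite integralZl// -(setTI setT) -(preimage_setT X) setTI cD0// mule0.
  have iDC : P.-integrable setT (fun w => (D w * C)%:E).
    under eq_fun do rewrite mulrC EFinM.
    exact: integrableZl.
  have iDh : P.-integrable setT (fun w => (D w * h (X w))%:E).
    by apply: (integral_bounded_mul (C := C)) => //; exact: measurableT_comp.
  have := wlg (fun x => h x + C) (C + C).
  under eq_integral do rewrite mulrDr EFinD.
  rewrite integralD// D0 adde0; apply.
  - exact: measurable_funD.
  - move=> x; rewrite (le_trans (ler_normD _ _))// lerD//.
    by rewrite ger0_norm// (le_trans _ (hC x)).
  - by move=> x; have := hC x; rewrite ler_norml => /andP[+ _];
      rewrite -subr_ge0 opprK.
have mh' : measurable_fun setT (EFin \o h) by exact: measurableT_comp.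
pose s := nnsfun_approx measurableT mh'.
have sE k x : s k x <= h x.
  rewrite -lee_fin; rewrite /s nnsfun_approxE; apply: le_approx => // t _.
  by rewrite lee_fin.
have scvg x : EFin \o (s ^~ x) @ \oo --> (h x)%:E.
  by apply: (cvg_nnsfun_approx measurableT mh') => // t _; rewrite lee_fin.
have mD : measurable_fun setT D.
  by apply/measurable_EFinP; exact: (measurable_int P iD).
have [||||| _ _ ] := @dominated_convergence _ _ _ P setT measurableT
   (fun k w => (D w * s k (X w))%:E) (fun w => (D w * h (X w))%:E)
   (fun w => (`|D w| * C)%:E).
- move=> k; apply/measurable_EFinP/measurable_funM => //.
  exact: measurableT_comp.
- apply/measurable_EFinP/measurable_funM => //.
  exact: measurableT_comp.
- apply: aeW => w _.
  under eq_fun do rewrite EFinM.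
  by rewrite EFinM; apply: cvgeZl => //; exact: scvg.
- under eq_fun do rewrite mulrC EFinM.
  by apply: integrableZl => //; exact: integrable_norm.
- apply: aeW => w k _; rewrite lee_fin normrM ler_wpM2l//.
  by rewrite ger0_norm// (le_trans (sE k _))// (le_trans _ (hC (X w)))//
    ler_norm.
under eq_fun do rewrite centered_nnsfun//.
move=> /cvg_lim <-//.
by rewrite lim_cst.
Qed.

Lemma conditionally_centeredB (D1 D2 : Omega -> R) :
  conditionally_centered D1 -> conditionally_centered D2 ->
  conditionally_centered (D1 \- D2).
Proof.
move=> [i1 c1] [i2 c2]; split.
  exact: (integrableB measurableT i1 i2).
move=> B mB; have iB f := @integrableS _ _ _ P _ _ f measurableT (mpre mB)
  (@subsetT _ _).
by rewrite (integralB_EFin (mpre mB) (iB _ i1) (iB _ i2)) c1// c2// sube0.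
Qed.

Lemma conditionally_centeredZ (k : R) (D : Omega -> R) :
  conditionally_centered D -> conditionally_centered (fun w => k * D w).
Proof.
move=> [iD cD]; split; first exact: (integrableZl measurableT k iD).
move=> B mB; have mXB := mpre mB.
have iDB := integrableS measurableT mXB (@subsetT _ _) iD.
by have := integralZl mXB iDB k; rewrite cD// mule0.
Qed.

(** The natural test function [f] may be unbounded, so [f] clipped to [-1, 1] is used instead: the
    product with [f] is nonnegative and vanishes only where [f] does. *)
Lemma conditionally_centered_fun (f : T -> R) : measurable_fun setT f ->
  conditionally_centered (f \o X) -> {ae P, forall w, f (X w) = 0}.
Proof.
move=> mf cf; pose h x := Num.min (Num.max (f x) (-1)) 1.
have mh : measurable_fun setT h.
  by apply: measurable_minr => //; exact: measurable_maxr.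
have hle x : `|h x| <= 1.
  rewrite /h ler_norml minEle maxEle.
  by case: ifPn; case: ifPn; rewrite -?ltNge => ? ?; apply/andP; split; lra.
have fh0 x : 0 <= f x * h x.
  by rewrite /h minEle maxEle; case: ifPn; case: ifPn; rewrite -?ltNge => ? ?;
    nra.
have mfh : measurable_fun setT (fun w => (f (X w) * h (X w))%:E).
  apply/measurable_EFinP/measurable_funM; exact: measurableT_comp.
have := conditionally_centered_bounded cf mh hle.
under eq_integral => w _ do rewrite -[X in (X%:E)](ger0_norm (fh0 (X w))).
move=> /(ae_eq_integral_abs P measurableT mfh).
apply: filterS => w /= /(_ I) [] /eqP.
rewrite mulf_eq0 /h => /orP[/eqP//|].
by rewrite minEle maxEle; case: ifPn; case: ifPn; rewrite -?ltNge => ? ? /eqP;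
  lra.
Qed.

Lemma cond_exp_unique (Z : Omega -> R) (f g : T -> R) :
  measurable_fun setT f -> measurable_fun setT g ->
  conditionally_centered (fun w => Z w - f (X w)) ->
  conditionally_centered (fun w => Z w - g (X w)) ->
  {ae P, forall w, f (X w) = g (X w)}.
Proof.
move=> mf mg cf cg.
have mgf : measurable_fun setT (g \- f) by exact: measurable_funB.
have : conditionally_centered ((g \- f) \o X).
  have -> : (g \- f) \o X =
      (fun w => Z w - f (X w)) \- (fun w => Z w - g (X w)).
    by apply/funext => w /=; lra.
  exact: conditionally_centeredB.
by move=> /(conditionally_centered_fun mgf); apply: filterS => w /=; lra.
Qed.

(* With [D = Z - f(X)], [h = g - f] and [U = Z - g(X)], on [|h| <= k] one has
   [D^2 <= U^2 + 2 D h], and [D h(X)] integrates to 0 there; then [k] tends to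
   infinity. No square integrability is needed. *)
Lemma cond_exp_minimizes (Z : Omega -> R) (f g : T -> R) :
  measurable_fun setT f -> measurable_fun setT g ->
  conditionally_centered (fun w => Z w - f (X w)) ->
  (\int[P]_w ((Z w - f (X w)) ^+ 2)%:E <=
   \int[P]_w ((Z w - g (X w)) ^+ 2)%:E)%E.
Proof.
move=> mf mg cD.
have mD : measurable_fun setT (fun w => Z w - f (X w)).
  by apply/measurable_EFinP; exact: (measurable_int P cD.1).
have mfX : measurable_fun setT (f \o X) by exact: measurableT_comp.
have mgX : measurable_fun setT (g \o X) by exact: measurableT_comp.
have mU : measurable_fun setT (fun w => Z w - g (X w)).
  have -> : (fun w => Z w - g (X w)) =
      (fun w => Z w - f (X w)) \+ ((f \o X) \- (g \o X)).
    by apply/funext => w /=; lra.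
  by apply: measurable_funD => //; exact: measurable_funB.
set RHS := (X in (_ <= X)%E).
(* When the loss of [g] is finite, [Z - g(X)] is square integrable, which allows the integral of
   [U^2 + 2 D h] to be split below. *)
have [->|RHSoo] := eqVneq RHS +oo%E; first by rewrite leey.
have iU : P.-integrable setT (EFin \o (fun w => (Z w - g (X w)) ^+ 2)).
  apply/integrableP; split.
    by apply/measurable_EFinP; exact: measurable_funX.
  under eq_integral do rewrite /= ger0_norm ?sqr_ge0//.
  by rewrite ltey.
pose h x := g x - f x.
have mh : measurable_fun setT h by exact: measurable_funB.
pose A (k : nat) := [set x | `|h x| <= k%:R].
have mA k : measurable (A k).
  rewrite -[X in measurable X]setTI; apply: measurable_fun_le => //.
  exact: measurableT_comp.
have le_k k : (\int[P]_(w in X @^-1` A k) ((Z w - f (X w)) ^+ 2)%:E <= RHS)%E.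
  pose hk x := h x * \1_(A k) x.
  have mhk : measurable_fun setT hk.
    by apply: measurable_funM => //; exact: measurable_indic.
  have hkle x : `|hk x| <= k%:R.
    rewrite /hk indicE; case: (boolP (x \in A k)) => [/set_mem|_].
      by rewrite mulr1.
    by rewrite mulr0 normr0.
  have iDh : P.-integrable setT
      (EFin \o (fun w => (Z w - f (X w)) * hk (X w))).
    apply: (integral_bounded_mul (C := k%:R)) => //; first exact: cD.1.
    exact: measurableT_comp.
  have iDh2 := integrableZl measurableT 2 iDh.
  rewrite -integral_mul_indic.
  have -> : RHS = (\int[P]_w (((Z w - g (X w)) ^+ 2)%:E +
     2%:E * ((Z w - f (X w)) * hk (X w))%:E))%E.
    rewrite (integralD measurableT iU iDh2) (integralZl measurableT iDh).
    by rewrite (conditionally_centered_bounded cD mhk hkle) mule0 adde0.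
  apply: ge0_le_integral => //.
  - by move=> w _; rewrite lee_fin mulr_ge0// sqr_ge0.
  - apply/measurable_EFinP/measurable_funM; first exact: measurable_funX.
    exact/measurable_indic/mpre.
  - exact: measurable_int (integrableD measurableT iU iDh2).
  - move=> w _ /=; rewrite -EFinM -EFinD lee_fin /hk !indicE.
    have -> : (w \in X @^-1` A k) = (X w \in A k) by [].
    case: (X w \in A k); rewrite ?mulr1 ?mulr0 ?addr0 ?sqr_ge0//.
    by rewrite /h -subr_ge0; have := sqr_ge0 (g (X w) - f (X w)); lra.
have -> : (\int[P]_w ((Z w - f (X w)) ^+ 2)%:E =
    \int[P]_(w in \bigcup_k (X @^-1` A k)) ((Z w - f (X w)) ^+ 2)%:E)%E.
  congr integral; apply/esym/seteqP; split => // w _.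
  by exists (Num.bound `|h (X w)|) => //=; rewrite /A/= ltW// archi_boundP.
have mD2 : measurable_fun setT (fun w => ((Z w - f (X w)) ^+ 2)%:E).
  by apply/measurable_EFinP; exact: measurable_funX.
have cvgI : (\int[P]_(w in X @^-1` A k) ((Z w - f (X w)) ^+ 2)%:E @[k --> \oo]
    --> \int[P]_(w in \bigcup_k (X @^-1` A k)) ((Z w - f (X w)) ^+ 2)%:E)%E.
  apply: ge0_nondecreasing_set_cvg_integral.
  - move=> k l kl; apply/subsetPset => w /=; rewrite /A/= => /le_trans; apply.
    by rewrite ler_nat.
  - by move=> k; exact: mpre.
  - by move=> k; exact: (measurable_funTS mD2).
  - by move=> k w _; rewrite lee_fin sqr_ge0.
rewrite -(cvg_lim _ cvgI)//; apply: lime_le; last exact: nearW.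
exact: cvgP cvgI.
Qed.

(* Perturbing by [c 1_B(X)] changes the square loss by [c^2 p - 2 c a], with
   [a] the integral of [D] over [X^-1 B]; take [c = a]. *)
Lemma minimizer_conditionally_centered (D : Omega -> R) :
  measurable_fun setT D -> (\int[P]_w (D w ^+ 2)%:E < +oo)%E ->
  (forall B (c : R), measurable B ->
    (\int[P]_w (D w ^+ 2)%:E <=
     \int[P]_w ((D w - c * \1_B (X w)) ^+ 2)%:E)%E) ->
  conditionally_centered D.
Proof.
move=> mD D2 Dmin.
have mD2 : measurable_fun setT (EFin \o (fun w => D w ^+ 2)).
  by apply/measurable_EFinP; exact: measurable_funX.
have iD2 : P.-integrable setT (EFin \o (fun w => D w ^+ 2)).
  apply/integrableP; split => //.
  by under eq_integral do rewrite /= ger0_norm ?sqr_ge0//.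
have iD : P.-integrable setT (EFin \o D).
  (* Integrability of [D] comes from [|D| <= 1 + D^2] and the finiteness of [P]. *)
  have i1 : P.-integrable setT (EFin \o cst 1).
    exact: finite_measure_integrable_cst.
  apply: le_integrable (integrableD measurableT i1 iD2) => //.
    exact/measurable_EFinP.
  move=> w _ /=; rewrite lee_fin [leRHS]ger0_norm ?addr_ge0 ?sqr_ge0//.
  by rewrite ler_norml; apply/andP; split; nra.
split => // B mB.
have mXB := mpre mB.
have iDB : P.-integrable setT (EFin \o (fun w => D w * \1_(X @^-1` B) w)).
  apply: (integral_bounded_mul (C := 1)) => // w.
  by rewrite indicE; case: (_ \in _); rewrite ?normr1// normr0.
have i1B : P.-integrable setT (EFin \o (\1_(X @^-1` B) : Omega -> R)).
  exact: integrable_indic.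
have fa : (\int[P]_(w in X @^-1` B) (D w)%:E)%E \is a fin_num.
  apply: integrable_fin_num => //; exact: integrableS iD.
have fp := fin_num_measure P _ mXB.
set a := fine (\int[P]_(w in X @^-1` B) (D w)%:E)%E.
have aE : (\int[P]_(w in X @^-1` B) (D w)%:E)%E = a%:E by rewrite fineK.
have f2 : (\int[P]_w (D w ^+ 2)%:E)%E \is a fin_num.
  exact: integrable_fin_num.
have := Dmin B a mB.
have -> : (\int[P]_w ((D w - a * \1_B (X w)) ^+ 2)%:E =
   \int[P]_w (D w ^+ 2)%:E + ((- (2 * a))%:E * a%:E
     + (a ^+ 2)%:E * P (X @^-1` B)))%E.
  have -> : P (X @^-1` B) = (\int[P]_w (\1_(X @^-1` B) w)%:E)%E.
    by rewrite integral_indic// setIT.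
  rewrite -aE -(integral_mul_indic P (X @^-1` B) D).
  have j1 := integrableZl measurableT (- (2 * a)) iDB.
  have j2 := integrableZl measurableT (a ^+ 2) i1B.
  rewrite -[X in (_ + (X + _))%E](integralZl measurableT iDB).
  rewrite -[X in (_ + (_ + X))%E](integralZl measurableT i1B).
  rewrite -[X in (_ + X)%E](integralD measurableT j1 j2).
  rewrite -[RHS](integralD measurableT iD2 (integrableD measurableT j1 j2)).
  apply: eq_integral => w _ /=; rewrite -!EFinM -!EFinD.
  have -> : \1_B (X w) = \1_(X @^-1` B) w :> R by rewrite !indicE.
  congr EFin; rewrite indicE; case: (_ \in _) => /=; ring.
rewrite -(fineK f2) -(fineK fp) -!EFinM -!EFinD lee_fin lerDl.
(* For [c = a] the loss changes by [a^2 (p - 2)]; since [p <= 1], this is negative unless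
   [a = 0]. *)
have p1 : fine (P (X @^-1` B)) <= 1.
  by rewrite -lee_fin fineK// probability_le1.
have p0 : 0 <= fine (P (X @^-1` B)) by exact: fine_ge0.
rewrite aE => H; have : a = 0 by nra.
by move=> ->.
Qed.

End conditionally_centered.

Lemma ae_forall_count {d} {T : measurableType d} {R : realType}
    (mu : {measure set T -> \bar R}) (I : countType) (Q : I -> T -> Prop) :
  (forall i, {ae mu, forall x, Q i x}) -> {ae mu, forall x i, Q i x}.
Proof.
move=> aeQ.
have : {ae mu, forall x (k : nat),
    if choice.unpickle k is Some i then Q i x else True}.
  apply: ae_foralln => k; case: choice.unpickle => [i|]; first exact: aeQ.
  exact: aeW.
by apply: filterS => x Qx i; have := Qx (choice.pickle i);
  rewrite choice.pickleK.
Qed.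

(** * Vector-valued regression *)

Section regression.
Context {R : realType} {n : nat} {d d' : measure_display}.
Context {Omega : measurableType d} {T : measurableType d'}.
Variables (P : probability Omega R) (Z : Omega -> 'rV[R]_n) (X : Omega -> T).
Hypotheses (mZ : measurable_fun setT Z) (mX : measurable_fun setT X).

(** Conditional expectation expressed through its residual. Compared with [is_cond_exp], the
    observation may live in any measurable space, which the pair of macro signal and time
    requires. *)
Definition is_regression (f : T -> 'rV[R]_n) : Prop :=
  measurable_fun setT f /\
  forall j, conditionally_centered P X (fun w => Z w ord0 j - f (X w) ord0 j).

Definition square_loss (f : T -> 'rV[R]_n) : \bar R :=
  (\int[P]_w (sqnorm (Z w - f (X w)))%:E)%E.

Definition minimizes_square_loss (f : T -> 'rV[R]_n) : Prop :=
  measurable_fun setT f /\ forall g : T -> 'rV[R]_n, measurable_fun setT g ->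
    (square_loss f <= square_loss g)%E.

Let mres (f : T -> 'rV[R]_n) j : measurable_fun setT f ->
  measurable_fun setT (fun w => Z w ord0 j - f (X w) ord0 j).
Proof.
move=> mf; apply: measurable_funB.
  exact: (measurable_rVP Z).1.
exact: (measurableT_comp ((measurable_rVP f).1 mf j) mX).
Qed.

Let mres2 (f : T -> 'rV[R]_n) j : measurable_fun setT f ->
  measurable_fun setT (fun w => ((Z w ord0 j - f (X w) ord0 j) ^+ 2)%:E).
Proof.
by move=> mf; apply/measurable_EFinP/measurable_funX/mres.
Qed.

Let square_lossE (f : T -> 'rV[R]_n) : measurable_fun setT f -> square_loss f =
  (\sum_(j < n) \int[P]_w ((Z w ord0 j - f (X w) ord0 j) ^+ 2)%:E)%E.
Proof.
move=> mf; rewrite /square_loss.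
under eq_integral => w _.
  rewrite /sqnorm -sumEFin; under eq_bigr => j _ do rewrite !mxE.
  over.
rewrite ge0_integral_sum//; first by move=> j; exact: mres2.
by move=> j w _; rewrite lee_fin sqr_ge0.
Qed.

Lemma exists_regression :
  integrable_vector P Z -> exists f, is_regression f.
Proof.
move=> iZ.
have /choice[f fP] : forall j, exists g : T -> R, [/\ measurable_fun setT g,
    P.-integrable setT (EFin \o (g \o X)) &
    forall B, measurable B -> (\int[P]_(w in X @^-1` B) (g (X w))%:E
      = \int[P]_(w in X @^-1` B) (Z w ord0 j)%:E)%E].
  by move=> j; exact: (exists_cond_exp mX (iZ j)).
exists (fun x => \row_j f j x); split.
  apply/measurable_rVP => j; under eq_fun do rewrite mxE.
  by have [] := fP j.
move=> j; have [mf ifX fE] := fP j; under eq_fun do rewrite mxE.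
split; first exact: (integrableB measurableT (iZ j) ifX).
move=> B mB.
have mXB := measurable_preimageT mX mB.
have iS g := @integrableS _ _ _ P _ _ g measurableT mXB (@subsetT _ _).
rewrite (integralB_EFin mXB (iS _ (iZ j)) (iS _ ifX)) fE// subee//.
exact: (integrable_fin_num mXB (iS _ (iZ j))).
Qed.

Lemma regression_minimizes (f : T -> 'rV[R]_n) : is_regression f ->
  minimizes_square_loss f.
Proof.
move=> [mf cf]; split => // g mg.
rewrite !square_lossE//; apply: lee_sum => j _.
by apply: (@cond_exp_minimizes _ _ _ _ _ P X mX (fun w => Z w ord0 j)
  (fun x => f x ord0 j) (fun x => g x ord0 j)) => //;
    exact: (measurable_rVP _).1.
Qed.

(** The competitor [g] of finite loss is essential: if every loss were infinite, every measurable
    [f] would be a minimizer. *)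
Lemma minimizes_regression (f g : T -> 'rV[R]_n) : measurable_fun setT g ->
  (square_loss g < +oo)%E -> minimizes_square_loss f -> is_regression f.
Proof.
move=> mg g_fin [mf fmin]; split => // j.
have f_fin : (square_loss f < +oo)%E by apply: le_lt_trans (fmin g mg) g_fin.
have mcoord (h : T -> 'rV[R]_n) : measurable_fun setT h ->
  (0 <= \sum_(i < n | i != j)
    \int[P]_w ((Z w ord0 i - h (X w) ord0 i) ^+ 2)%:E)%E.
  by move=> mh; apply: sume_ge0 => i _; apply: integral_ge0 => w _;
    rewrite lee_fin sqr_ge0.
apply: minimizer_conditionally_centered => //.
- exact: mres.
- apply: le_lt_trans f_fin; rewrite square_lossE// (bigD1 j)//=.
  by rewrite leeDl// mcoord.
move=> B c mB.
(* Only coordinate [j] is perturbed, which reduces the vector problem to the scalar one. *)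
pose h x := f x + (c * \1_B x) *: delta_mx ord0 j.
have hE x i : h x ord0 i = f x ord0 i + (c * \1_B x) * (i == j)%:R.
  by rewrite /h !mxE eqxx.
have mh : measurable_fun setT h.
  apply/measurable_rVP => i; under eq_fun do rewrite hE.
  apply: measurable_funD; first exact: (measurable_rVP f).1.
  apply: measurable_funM => //; apply: measurable_funM => //.
have := fmin h mh; rewrite square_lossE// [leRHS]square_lossE//.
rewrite (bigD1 j)//= [leRHS](bigD1 j)//=.
under [X in (_ <= _ + X)%E]eq_bigr => i /negbTE ij.
  under eq_integral do rewrite hE ij mulr0 addr0.
  over.
(* The losses of the other coordinates cancel because they are finite. *)
rewrite leeD2rE//; last first.
  rewrite ge0_fin_numE; last exact: mcoord.
  apply: le_lt_trans f_fin; rewrite square_lossE// [leRHS](bigD1 j)//=.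
  by rewrite leeDr//; apply: integral_ge0 => w _; rewrite lee_fin sqr_ge0.
under [X in (_ <= X)%E]eq_integral do rewrite hE eqxx mulr1 opprD addrA.
by [].
Qed.

Lemma regression_unique (f g : T -> 'rV[R]_n) : is_regression f ->
  is_regression g ->
  {ae P, forall w, f (X w) = g (X w)}.
Proof.
move=> [mf cf] [mg cg].
have ae_coord j : {ae P, forall w, f (X w) ord0 j = g (X w) ord0 j}.
  by apply: (@cond_exp_unique _ _ _ _ _ P X mX (fun w => Z w ord0 j)
    (fun x => f x ord0 j) (fun x => g x ord0 j)) => //;
      exact: (measurable_rVP _).1.
have : {ae P, forall w (j : 'I_n), f (X w) ord0 j = g (X w) ord0 j}.
  exact: ae_forall_count.
by apply: filterS => w fg; apply/rowP.
Qed.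

End regression.

Section cond_exp.
Context {R : realType} {n : nat} {d : measure_display}.
Context {Omega : measurableType d}.
Variables (P : probability Omega R) (Z X : Omega -> 'rV[R]_n).
Hypotheses (mZ : measurable_fun setT Z) (mX : measurable_fun setT X).

Lemma is_cond_exp_regression (f : 'rV[R]_n -> 'rV[R]_n) :
  integrable_vector P Z -> is_cond_exp P Z X f <-> is_regression P Z X f.
Proof.
move=> iZ.
have mpre B : measurable B -> measurable (X @^-1` B).
  exact: measurable_preimageT.
have iS g B mB := @integrableS _ _ _ P _ _ g measurableT (mpre B mB)
  (@subsetT _ _).
split=> [[mf ifX fE]|[mf cf]].
  split => // j; split; first exact: (integrableB measurableT (iZ j) (ifX j)).
  move=> B mB; have mXB := mpre _ mB.
  rewrite (integralB_EFin mXB (iS _ _ mB (iZ j)) (iS _ _ mB (ifX j))) fE//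
    subee//.
  exact: (integrable_fin_num mXB (iS _ _ mB (iZ j))).
have ifX : integrable_vector P (f \o X).
  move=> j; have := integrableB measurableT (iZ j) (cf j).1.
  by apply: eq_integrable => // w _ /=; rewrite -EFinB; congr EFin; lra.
split => // B j mB; have mXB := mpre _ mB; have [_ /(_ B mB)] := cf j.
have iZB := iS _ _ mB (iZ j); have ifB := iS _ _ mB (ifX j).
rewrite (integralB_EFin mXB iZB ifB).
have := integrable_fin_num mXB iZB; have := integrable_fin_num mXB ifB.
by move=> ? ? /eqP; rewrite sube_eq ?add0e// => /eqP ->.
Qed.

(** All agents have the same utility, so the average over the unit interval is constant.
    Nonnegativity of the loss lets the sign leave the integral even when the value is infinite. *)
Lemma expected_welfareE (psi : 'rV[R]_n -> 'rV[R]_n) :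
  expected_welfare P (psi \o X) Z = (- square_loss P Z X psi)%E.
Proof.
rewrite /expected_welfare /square_loss -integral_ge0N; last first.
  by move=> w _; rewrite lee_fin sumr_ge0// => j _; rewrite sqr_ge0.
apply: eq_integral => w _; congr EFin.
rewrite /welfare /utility Rintegral_cst//=.
rewrite lebesgue_measure_itv/= lte01 oppr0 adde0/= mulr1; congr (- _).
by rewrite /sqnorm; apply: eq_bigr => j _; rewrite !mxE; ring.
Qed.

Lemma welfare_maximizingE (phi : 'rV[R]_n -> 'rV[R]_n) :
  welfare_maximizing P Z X phi <-> minimizes_square_loss P Z X phi.
Proof.
split=> -[mphi opt].
  split; first exact: mphi.
  move=> psi mpsi; have := opt psi mpsi.
  by rewrite (expected_welfareE psi) (expected_welfareE phi) leeN2; exact: id.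
split; first exact: mphi.
move=> psi mpsi.
rewrite (expected_welfareE psi) (expected_welfareE phi) leeN2.
exact: opt.
Qed.

End cond_exp.

(** * Gaussian noise and the average report *)

Section normal_moments.
Context {R : realType}.
Notation mu := (@lebesgue_measure R).

(** The abstract Radon-Nikodym derivative of [normal_prob] and [normal_pdf] have the same integral
    over every measurable set, hence agree almost everywhere; the change of variables for the former
    then holds for the latter. *)
Lemma ge0_integral_normal_prob (m s : R) (f : R -> \bar R) :
  measurable_fun setT f -> (forall x, 0 <= f x)%E ->
  (\int[normal_prob m s]_x f x = \int[mu]_x (f x * (normal_pdf m s x)%:E))%E.
Proof.
move=> mf f0.
have dom := normal_prob_dominates m s.
rewrite -(Radon_Nikodym_SigmaFinite.change_of_variables dom)//.
have mg := measurable_int _ (Radon_Nikodym_SigmaFinite.f_integrable dom).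
have mpdf : measurable_fun setT (fun x => (normal_pdf m s x)%:E).
  by apply/measurable_EFinP; exact: measurable_normal_pdf.
have : ae_eq mu setT (Radon_Nikodym_SigmaFinite.f (normal_prob m s) mu)
    (fun x => (normal_pdf m s x)%:E).
  apply: integral_ae_eq => //.
    exact: Radon_Nikodym_SigmaFinite.f_integrable.
  by move=> E _ mE; rewrite -Radon_Nikodym_SigmaFinite.f_integral.
move=> aeE; apply: ae_eq_integral => //; [exact: emeasurable_funM..|].
by apply: filterS aeE => x /= + _ => /(_ I) ->.
Qed.

Lemma centered_normal_pdfE (s x : R) : 0 < s ->
  normal_pdf 0 s x = normal_peak s * expR (- x ^+ 2 / (s ^+ 2 *+ 2)).
Proof. by move=> s0; rewrite /normal_pdf gt_eqF// /normal_fun subr0. Qed.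

(** The image of Lebesgue measure under reflection gives each []a, b]] its length, so by uniqueness
    it is Lebesgue measure. *)
Lemma ge0_integral_oppr (f : R -> \bar R) :
  measurable_fun setT f -> (forall x, 0 <= f x)%E ->
  (\int[mu]_x f (- x)%R = \int[mu]_x f x)%E.
Proof.
move=> mf f0.
have mN : measurable_fun [set: measurableTypeR R]
    (-%R : R -> measurableTypeR R) by [].
transitivity (\int[pushforward mu (-%R : R -> measurableTypeR R)]_x f x)%E.
  by rewrite ge0_integral_pushforward.
apply: eq_measure_integral => A mA _; apply/esym.
apply: (@lebesgue_measure_unique R
  (pushforward mu (-%R : R -> measurableTypeR R))) => //.
move=> _ [[a b] _ <-] /=.
rewrite /pushforward.
have -> : (-%R @^-1` `]a, b] : set R) = `[- b, - a[%classic.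
  by apply/seteqP; split => x /=; rewrite !in_itv/= => /andP[? ?];
    apply/andP; split; lra.
by rewrite !lebesgue_measure_itv/= !lte_fin ltrN2 opprK addrC.
Qed.

Lemma normal_prob_second_moment (s : R) : 0 < s ->
  (\int[normal_prob 0 s]_x (x ^+ 2)%:E < +oo)%E.
Proof.
move=> s0.
have s20 : 2 * s != 0 by lra.
rewrite ge0_integral_normal_prob; last 2 first.
- by apply/measurable_EFinP; exact: measurable_funX.
- by move=> x; rewrite lee_fin sqr_ge0.
(* [x^2 exp(-x^2/2s^2) <= 8 s^2 exp(-x^2/8s^2)], a multiple of the density of
   N(0, (2s)^2). *)
pose K := 8 * s ^+ 2 * (normal_peak s / normal_peak (2 * s)).
have K0 : 0 <= K.
  apply: mulr_ge0; first by apply: mulr_ge0 => //; exact: sqr_ge0.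
  by apply: divr_ge0; exact: normal_peak_ge0.
apply: (@le_lt_trans _ _ (\int[mu]_x (K%:E * (normal_pdf 0 (2 * s) x)%:E))%E);
  last first.
  rewrite ge0_integralZl//.
  - by rewrite integral_normal_pdf mule1 ltry.
  - by apply/measurable_EFinP; exact: measurable_normal_pdf.
  - by move=> x _; rewrite lee_fin normal_pdf_ge0.
apply: ge0_le_integral => //.
- by move=> x _; rewrite -EFinM lee_fin mulr_ge0 ?sqr_ge0 ?normal_pdf_ge0.
- by apply: emeasurable_funM; apply/measurable_EFinP;
    [exact: measurable_funX|exact: measurable_normal_pdf].
- by apply: emeasurable_funM => //; apply/measurable_EFinP;
    exact: measurable_normal_pdf.
move=> x _; rewrite -!EFinM lee_fin !centered_normal_pdfE ?mulr_gt0//.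
(* In terms of [u] the exponents of the two densities are [-4u] and [-u]. The claim becomes
   [u * expR (- (3 * u)) <= 1], which follows from [1 + 3u <= expR (3u)]; the factor [8 * s ^+ 2] of
   [K] is [x^2 / u]. *)
set u := x ^+ 2 / (8 * s ^+ 2).
have u0 : 0 <= u.
  by apply: divr_ge0; [exact: sqr_ge0|apply: mulr_ge0 => //; exact: sqr_ge0].
have s2 : s ^+ 2 != 0 by rewrite expf_neq0// gt_eqF.
have -> : - x ^+ 2 / (s ^+ 2 *+ 2) = - u - 3 * u.
  by rewrite /u; field; rewrite gt_eqF.
have -> : - x ^+ 2 / ((2 * s) ^+ 2 *+ 2) = - u.
  by rewrite /u; field; rewrite gt_eqF.
have -> : x ^+ 2 = 8 * s ^+ 2 * u by rewrite /u; field; rewrite gt_eqF.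
have pk : normal_peak (2 * s) != 0 by rewrite gt_eqF// normal_peak_gt0.
have -> : K * (normal_peak (2 * s) * expR (- u)) =
    8 * s ^+ 2 * normal_peak s * expR (- u).
  by rewrite /K; field.
have -> : 8 * s ^+ 2 * u * (normal_peak s * expR (- u - 3 * u)) =
    8 * s ^+ 2 * normal_peak s * expR (- u) * (u * expR (- (3 * u))).
  by rewrite expRD; ring.
apply: ler_piMr.
  apply: mulr_ge0; last exact: expR_ge0.
  apply: mulr_ge0; last exact: normal_peak_ge0.
  by apply: mulr_ge0 => //; exact: sqr_ge0.
by rewrite expRN ler_pdivrMr ?expR_gt0// mul1r (le_trans _ (expR_ge1Dx _))//;
  lra.
Qed.

Lemma normal_prob_integrable_id (s : R) : 0 < s ->
  (normal_prob 0 s).-integrable setT (EFin \o id).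
Proof.
move=> s0.
have i1 : (normal_prob 0 s).-integrable setT (EFin \o cst 1).
  exact: finite_measure_integrable_cst.
have i2 : (normal_prob 0 s).-integrable setT (EFin \o (fun x => x ^+ 2)).
  apply/integrableP; split.
    by apply/measurable_EFinP; exact: measurable_funX.
  under eq_integral do rewrite /= ger0_norm ?sqr_ge0//.
  exact: normal_prob_second_moment.
apply: le_integrable (integrableD measurableT i1 i2) => //.
  exact/measurable_EFinP.
move=> w _ /=; rewrite lee_fin [leRHS]ger0_norm ?addr_ge0 ?sqr_ge0//.
by rewrite ler_norml; apply/andP; split; nra.
Qed.

(** Reflection exchanges the positive and negative parts of [x] and preserves the even density. The
    two parts have equal integrals, which may be subtracted because they are finite. *)
Lemma normal_prob_mean (s : R) : 0 < s ->
  (\int[normal_prob 0 s]_x x%:E = 0)%E.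
Proof.
move=> s0; rewrite integralE.
have mid : measurable_fun setT (fun x : R => x%:E) by exact/measurable_EFinP.
have symm : (\int[normal_prob 0 s]_x (fun x : R => x%:E)^\+ x =
    \int[normal_prob 0 s]_x (fun x : R => x%:E)^\- x)%E.
  rewrite !ge0_integral_normal_prob//; last 2 first.
  - exact: measurable_funeneg.
  - exact: measurable_funepos.
  rewrite -[LHS]ge0_integral_oppr.
  - apply: eq_integral => x _; congr (_ * _%:E)%E.
      by rewrite funeposE funenegE.
    by rewrite !centered_normal_pdfE// sqrrN.
  - apply: emeasurable_funM; first exact: measurable_funepos.
    by apply/measurable_EFinP; exact: measurable_normal_pdf.
  - by move=> x; rewrite mule_ge0// lee_fin normal_pdf_ge0.
rewrite symm subee//.
by apply: integrable_neg_fin_num => //; exact: normal_prob_integrable_id.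
Qed.

End normal_moments.

Section gaussian_coordinates.
Context {R : realType} {n : nat} {d : measure_display}.
Context {Omega : measurableType d}.
Variables (P : probability Omega R).

Lemma centered_gaussian_coord (s : R) (X : Omega -> 'rV[R]_n) (j : 'I_n)
    (B : set R) :
  measurable B -> centered_gaussian P s X ->
  P ((fun w => X w ord0 j) @^-1` B) = normal_prob 0 s B.
Proof.
move=> mB gX.
have := gX (fun i => if i == j then B else setT).
rewrite (bigD1 j)//= eqxx big1 ?mule1; last first.
  by move=> i /negbTE ->; exact: probability_setT.
move=> <-; last by move=> i; case: ifP.
congr (P _); apply/seteqP; split => [w/= Bw i|w /(_ j)]/=; last by rewrite eqxx.
by case: eqP => // ->.
Qed.

Variables (s : R) (s0 : 0 < s) (U : {RV P >-> R}).
Hypothesis lawU : forall B, measurable B -> P (U @^-1` B) = normal_prob 0 s B.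

(* [normal_prob] lives on [measurableTypeR R], whose sigma-algebra is
   convertible to that of [R] but has another display. *)
Let mU' : measurable_fun setT (U : Omega -> measurableTypeR R).
Proof.
by move=> _ A mA; rewrite setTI; exact: (@measurable_funPTI _ _ _ _ U A mA).
Qed.

Let U' : {RV P >-> measurableTypeR R} :=
  HB.pack (U : Omega -> measurableTypeR R)
    (isMeasurableFun.Build _ _ _ _ _ mU').

Let lawE (A : set (measurableTypeR R)) : measurable A -> A `<=` setT ->
  normal_prob 0 s A = distribution P U' A.
Proof. by move=> mA _; exact/esym/lawU. Qed.

Let ge0_law (f : measurableTypeR R -> \bar R) :
  measurable_fun setT f -> (forall x, 0 <= f x)%E ->
  (\int[normal_prob 0 s]_x f x = \int[P]_w f (U w))%E.
Proof.
move=> mf f0; rewrite -[RHS](ge0_integral_distribution U')//.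
exact: eq_measure_integral lawE.
Qed.

Lemma gaussian_second_moment : (\int[P]_w (U w ^+ 2)%:E =
  \int[normal_prob 0 s]_x (x ^+ 2)%:E)%E.
Proof.
rewrite (ge0_law (f := fun x => (x ^+ 2)%:E))//.
  by apply/measurable_EFinP; exact: measurable_funX.
by move=> x; rewrite lee_fin sqr_ge0.
Qed.

Lemma gaussian_square_integrable :
  P.-integrable setT (EFin \o (fun w => U w ^+ 2)).
Proof.
apply/integrableP; split.
  by apply/measurable_EFinP; exact: measurable_funX.
under eq_integral do rewrite /= ger0_norm ?sqr_ge0//.
by rewrite gaussian_second_moment normal_prob_second_moment.
Qed.

Lemma gaussian_integrable : P.-integrable setT (EFin \o U).
Proof.
apply/integrableP; split; first exact/measurable_EFinP.
have /integrableP[_] := normal_prob_integrable_id s0.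
by rewrite (ge0_law (f := fun x => `|x%:E|%E))//; exact: measurableT_comp.
Qed.

Lemma gaussian_mean : (\int[P]_w (U w)%:E = 0)%E.
Proof.
rewrite -(normal_prob_mean s0); apply/esym.
have iU := gaussian_integrable.
rewrite -[RHS](@integral_distribution _ _ _ _ _ P U' (fun x => x%:E))//.
  exact: eq_measure_integral lawE.
exact: (measurable_int _ (normal_prob_integrable_id s0)).
Qed.

End gaussian_coordinates.

(** * Uncorrelated noises and Bessel's inequality *)

Section uncorrelated.
Context {R : realType} {d : measure_display} {Omega : measurableType d}.
Variables (P : probability Omega R).

Lemma square_integrable_mul (U V : Omega -> R) :
  measurable_fun setT U -> measurable_fun setT V ->
  P.-integrable setT (EFin \o (fun w => U w ^+ 2)) ->
  P.-integrable setT (EFin \o (fun w => V w ^+ 2)) ->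
  P.-integrable setT (EFin \o (fun w => U w * V w)).
Proof.
move=> mU mV i1 i2.
apply: le_integrable (integrableD measurableT i1 i2) => //.
  by apply/measurable_EFinP; exact: measurable_funM.
move=> w _ /=; rewrite lee_fin [leRHS]ger0_norm ?addr_ge0 ?sqr_ge0//.
by rewrite ler_norml; apply/andP; split; nra.
Qed.

(** Independence makes the joint law of [(U, V)] the product of the marginals. By Fubini the inner
    integral at [x] is [x] times the mean of [V], which is 0. *)
Lemma independent_uncorrelated (U V : Omega -> R) :
  measurable_fun setT U -> measurable_fun setT V ->
  (forall A B : set R, measurable A -> measurable B ->
    P (U @^-1` A `&` V @^-1` B) = P (U @^-1` A) * P (V @^-1` B))%E ->
  P.-integrable setT (EFin \o U) -> P.-integrable setT (EFin \o V) ->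
  P.-integrable setT (EFin \o (fun w => U w * V w)) ->
  (\int[P]_w (V w)%:E = 0)%E ->
  (\int[P]_w (U w * V w)%:E = 0)%E.
Proof.
move=> mU mV indep iU iV iUV EV0.
pose U' : {RV P >-> R} := HB.pack U (isMeasurableFun.Build _ _ _ _ U mU).
pose V' : {RV P >-> R} := HB.pack V (isMeasurableFun.Build _ _ _ _ V mV).
have mW : measurable_fun setT (fun w => (U w, V w)).
  exact: measurable_fun_pair.
pose W : {RV P >-> (R * R)%type} :=
  HB.pack (fun w => (U w, V w)) (isMeasurableFun.Build _ _ _ _ _ mW).
have prodE A : measurable A ->
    (distribution P U' \x distribution P V')%E A = distribution P W A.
  move=> mA; apply: product_measure_unique => //.
pose f (z : R * R) := (z.1 * z.2)%:E.
have mf : measurable_fun setT f.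
  by apply/measurable_EFinP; exact: measurable_funM.
have -> : (\int[P]_w (U w * V w)%:E = \int[distribution P W]_z f z)%E.
  by rewrite integral_distribution.
have ifW : (distribution P W).-integrable setT f.
  exact: (@integrable_pushforward _ _ _ _ _ _ mW P setT f mf iUV measurableT).
have ifUV : (distribution P U' \x distribution P V')%E.-integrable setT f.
  apply/integrableP; split => //; have /integrableP[_] := ifW.
  rewrite [X in _ -> (X < _)%E](eq_measure_integral (distribution P W))//.
  by move=> A mA _; exact: prodE.
rewrite (eq_measure_integral (distribution P U' \x distribution P V')%E);
  last first.
  by move=> A mA _; exact/esym/prodE.
rewrite -integral12_prod_meas1//; apply: integral0_eq => x _.
rewrite /fubini_F /f/=; under eq_integral do rewrite EFinM.
have iV' : (distribution P V').-integrable setT (EFin \o id).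
  have mid : measurable_fun setT (EFin \o id : R -> \bar R).
    exact/measurable_EFinP.
  exact: (@integrable_pushforward _ _ _ _ _ _ mV P setT (EFin \o id) mid iV
    measurableT).
rewrite (integralZl measurableT iV').
have -> : (\int[distribution P V']_y (EFin \o id) y = \int[P]_w (V w)%:E)%E.
  rewrite integral_distribution//; exact/measurable_EFinP.
by rewrite EV0 mule0.
Qed.

End uncorrelated.

Section bessel.
Context {R : realType} {d : measure_display} {Omega : measurableType d}.
Variables (P : probability Omega R).
Variables (I : eqType) (D : set I) (e : I -> Omega -> R) (v : R).
Hypotheses (v0 : 0 < v) (me : forall i, D i -> measurable_fun setT (e i))
  (ie : forall i, D i -> P.-integrable setT (EFin \o (fun w => e i w ^+ 2)))
  (e2 : forall i, D i -> \int[P]_w (e i w ^+ 2) <= v)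
  (e_orth : forall i k, D i -> D k -> i != k -> \int[P]_w (e i w * e k w) = 0).

(** The [e i] are subtracted one at a time. Orthogonality leaves the pairings with the remaining
    [e k] unchanged, and each step lowers the squared norm by at least [c i ^+ 2 / v]. Since [v]
    only bounds the squared norms, the coefficient [c i / v] may fall short of the exact projection;
    the slack has the right sign. *)
Lemma bessel_inequality (Z : Omega -> R) (r : seq I) :
  measurable_fun setT Z -> P.-integrable setT (EFin \o (fun w => Z w ^+ 2)) ->
  uniq r -> (forall i, i \in r -> D i) ->
  \sum_(i <- r) (\int[P]_w (Z w * e i w)) ^+ 2 <= v * \int[P]_w (Z w ^+ 2).
Proof.
move=> mZ iZ.
set c := fun i => \int[P]_w (Z w * e i w).
(* [Y] is [Z] minus [\sum_(i <- r) (c i / v) e i]. *)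
suff : uniq r -> (forall i, i \in r -> D i) -> exists Y : Omega -> R,
    [/\ measurable_fun setT Y, P.-integrable setT (EFin \o (fun w => Y w ^+ 2)),
      forall k, D k -> k \notin r -> \int[P]_w (Y w * e k w) = c k &
      \int[P]_w (Y w ^+ 2) + (\sum_(i <- r) c i ^+ 2) / v <=
      \int[P]_w (Z w ^+ 2)].
  move=> H ur rD; have [Y [_ _ _]] := H ur rD.
  have : 0 <= \int[P]_w (Y w ^+ 2).
    by apply: Rintegral_ge0 => w _; exact: sqr_ge0.
  rewrite [X in _ -> _ -> _ <= X]mulrC -ler_pdivrMr//; lra.
elim: r => [_ _|a r IH /= /andP[ar ur] rD].
  by exists Z; split => //; rewrite big_nil mul0r addr0.
have [|Y [mY iY Yk YZ]] := IH ur.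
  by move=> i ir; apply: rD; rewrite inE ir orbT.
have Da : D a by apply: rD; rewrite mem_head.
have Yea := Yk a Da ar.
have iYe i : D i -> P.-integrable setT (EFin \o (fun w => Y w * e i w)).
  by move=> Di; apply: square_integrable_mul => //; [exact: me|exact: ie].
have iee i : D i -> P.-integrable setT (EFin \o (fun w => e a w * e i w)).
  by move=> Di; apply: square_integrable_mul; [exact: me..|exact: ie|exact: ie].
have RZl := fun k f i => @RintegralZl _ _ _ P setT f k measurableT i.
have IZl := fun k f i => @integrableZl _ _ _ P setT measurableT k (EFin \o f) i.
pose l := c a / v.
exists (fun w => Y w - l * e a w); split.
- by apply: measurable_funB => //; apply: measurable_funM => //; exact: me.
- have := integrableD measurableT (integrableD measurableT iY
    (IZl (- (2 * l)) _ (iYe a Da))) (IZl (l ^+ 2) _ (ie Da)).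
  apply: eq_integrable => // w _ /=; rewrite -!EFinM -!EFinD.
  by congr EFin; ring.
- move=> k Dk; rewrite inE negb_or => /andP[ka kr].
  rewrite -(Yk k Dk kr).
  transitivity (\int[P]_w (Y w * e k w + - l * (e a w * e k w))).
    by apply: eq_Rintegral => w _; ring.
  rewrite RintegralD//; [|exact: iYe|exact: (IZl _ _ (iee k Dk))].
  by rewrite (RZl _ _ (iee k Dk)) e_orth// 1?eq_sym// mulr0 addr0.
- rewrite big_cons.
  have -> : \int[P]_w ((Y w - l * e a w) ^+ 2) =
      \int[P]_w (Y w ^+ 2) +
      (- (2 * l) * c a + l ^+ 2 * \int[P]_w (e a w ^+ 2)).
    transitivity (\int[P]_w (Y w ^+ 2 +
        (- (2 * l) * (Y w * e a w) + l ^+ 2 * (e a w ^+ 2)))).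
      by apply: eq_Rintegral => w _; ring.
    have j1 := IZl (- (2 * l)) _ (iYe a Da).
    have j2 := IZl (l ^+ 2) _ (ie Da).
    rewrite (RintegralD measurableT iY (integrableD measurableT j1 j2)).
    rewrite (RintegralD measurableT j1 j2).
    by rewrite (RZl _ _ (iYe a Da)) (RZl _ _ (ie Da)) Yea.
  apply: le_trans YZ.
  have := e2 Da; set E := \int[P]_w _ => Ev.
  have key : - (2 * l) * c a + l ^+ 2 * E + c a ^+ 2 / v = l ^+ 2 * (E - v).
    by rewrite /l; field; rewrite gt_eqF.
  have : l ^+ 2 * (E - v) <= 0 by rewrite mulr_ge0_le0 ?sqr_ge0// subr_le0.
  rewrite -key [(c a ^+ 2 + _) / v]mulrDl; lra.
Qed.

End bessel.

(** For each [k] only finitely many terms [c i ^+ 2] can reach [1 / (k + 1)], as more than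
    [C (k + 1)] of them would exceed the bound. The nonzero terms are the union of these finite
    sets. *)
Lemma countable_square_summable {R : realType} {I : choiceType}
    (D : set I) (c : I -> R) (C : R) :
  (forall r : seq I, uniq r -> (forall i, i \in r -> D i) ->
    \sum_(i <- r) c i ^+ 2 <= C) ->
  countable [set i | D i /\ c i != 0].
Proof.
move=> cC.
have -> : [set i | D i /\ c i != 0] =
    \bigcup_k [set i | D i /\ k.+1%:R^-1 <= c i ^+ 2].
  apply/seteqP; split => i /=; last first.
    move=> [k _ [Di ki]]; split => //; apply: contraTneq ki => ->.
    by rewrite expr0n -ltNge invr_gt0.
  move=> [Di ci]; have c2 : 0 < c i ^+ 2 by rewrite exprn_even_gt0.
  exists (Num.bound (c i ^+ 2)^-1) => //; split => //.
  rewrite invf_ple ?posrE// ltW// (lt_trans (archi_boundP _))// ?invr_ge0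
    ?(ltW c2)//.
  by rewrite ltr_nat.
apply: bigcup_countable => // k _; apply: finite_set_countable.
apply: contrapT => infA.
have [B BA Bn] := infinite_set_fset (Num.bound (`|C| * k.+1%:R)) infA.
have := cC (enum_fset B) (fset_uniq B).
have BD i : i \in enum_fset B -> D i by move=> iB; have [] := BA i iB.
move=> /(_ BD); apply/negP; rewrite -ltNge.
apply: (@lt_le_trans _ _ (\sum_(i <- enum_fset B) k.+1%:R^-1)); last first.
  by rewrite !big_seq; apply: ler_sum => i iB; have [] := BA i iB.
rewrite big_const_seq count_predT iter_addr_0 -[ltRHS]mulr_natl ltr_pdivlMr//.
apply: (@le_lt_trans _ _ (`|C| * k.+1%:R)).
  by rewrite ler_pM2r// ler_norm.
by apply: (lt_le_trans (archi_boundP _)) => //; rewrite ler_nat.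
Qed.

(** Measurability of [f] is a conclusion here: every subset of the countable exceptional set is
    measurable, and off that set [f] is constant. The value is [a] because [0, 1] has length 1. *)
Lemma Rintegral_countable_exceptions {R : realType} (f : R -> R) (a : R) :
  countable [set i | 0 <= i <= 1 /\ f i != a] ->
  lebesgue_measure.-integrable `[(0 : R), 1]%classic (EFin \o f) /\
  \int[lebesgue_measure]_(i in `[0, 1]) f i = a.
Proof.
set N := [set i | _] => cN.
have mN A : countable A -> measurable (A : set R).
  by move=> cA; apply: countable_measurable.
have mf : measurable_fun `[(0 : R), 1]%classic f.
  move=> _ Y mY.
  have -> : `[(0 : R), 1]%classic `&` f @^-1` Y =
      (N `&` f @^-1` Y) `|` ((`[(0 : R), 1]%classic `\` N) `&` [set i | Y a]).
    apply/seteqP; split => i /=; rewrite in_itv/=.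
      move=> [i01 Yi]; have [fa|fa] := eqVneq (f i) a.
        by right; rewrite -fa; split => //; split => // -[_]; rewrite fa eqxx.
      by left; split.
    move=> [[[i01 _] Yi]|[[i01 Ni] Ya]]; first by split.
    split => //; have [->//|fa] := eqVneq (f i) a.
    by exfalso; apply: Ni; split.
  apply: measurableU.
    by apply: mN; apply: sub_countable cN; apply: subset_card_le;
      exact: subIsetl.
  apply: measurableI; last first.
    have [Ya|Ya] := pselect (Y a).
      by rewrite (_ : [set _ | _] = setT)//; apply/seteqP; split.
    by rewrite (_ : [set _ | _] = set0)//; apply/seteqP; split.
  by apply: measurableD => //; exact: mN.
have aefa : ae_eq lebesgue_measure `[(0 : R), 1]%classic
    (EFin \o f) (EFin \o cst a).
  exists N; split; first exact: mN.
    exact: countable_lebesgue_measure0.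
  move=> i /= H; rewrite /N/=; apply: contrapT => H2; apply: H.
  rewrite in_itv/= => i01; congr EFin; apply/eqP; apply: contrapT => /negP fa.
  by apply: H2; split.
have mu01 : lebesgue_measure `[(0 : R), 1]%classic = 1%E.
  by rewrite lebesgue_measure_itv/= lte01 oppr0 adde0.
have ica : lebesgue_measure.-integrable `[(0 : R), 1]%classic (EFin \o cst a).
  apply: measurable_bounded_integrable => //.
    by have := ltry (1 : R); rewrite -mu01.
  by exists `|a|; split; [exact: num_real|move=> C /ltW aC i _].
split.
  apply/integrableP; split; first exact/measurable_EFinP.
  have /integrableP[_] := ica.
  have mabs : measurable_fun `[(0 : R), 1]%classic
      (fun i => `|(EFin \o f) i|%E).
    by apply: measurableT_comp => //; exact/measurable_EFinP.
  suff -> : (\int[lebesgue_measure]_(i in `[0%R, 1%R]) `|(EFin \o f) i| =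
    \int[lebesgue_measure]_(i in `[0%R, 1%R]) `|(EFin \o cst a) i|)%E by [].
  apply: ae_eq_integral => //.
    exact: (measurable_cst `|a%:E|%E).
  by apply: filterS aefa => i /= H /H [->].
transitivity (\int[lebesgue_measure]_(i in `[0%R, 1%R]) a).
  rewrite /Rintegral; congr fine; apply: ae_eq_integral aefa => //;
    last exact: (measurable_cst a%:E).
  exact/measurable_EFinP.
by rewrite Rintegral_cst//= lebesgue_measure_itv/= lte01 oppr0 adde0/= mulr1.
Qed.

(** * The population integral of the reports *)

Section population.
Context {R : realType} {n : nat} {d : measure_display}.
Context {Omega : measurableType d}.
Variables (P : probability Omega R).

Definition coord_RV (X : {RV P >-> 'rV[R]_n}) (j : 'I_n) : {RV P >-> R} :=
  HB.pack (fun w => X w ord0 j)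
    (isMeasurableFun.Build _ _ _ _ _
      ((measurable_rVP X).1 (measurable_funPT X) j)).

Lemma bounded_RV_square_integrable (Z : {RV P >-> R}) (C : R) :
  (forall w, `|Z w| <= C) -> P.-integrable setT (EFin \o (fun w => Z w ^+ 2)).
Proof.
move=> ZC; have i1 : P.-integrable setT (EFin \o cst 1).
  exact: finite_measure_integrable_cst.
have -> : EFin \o (fun w => Z w ^+ 2) = (fun w => (cst 1 w * Z w ^+ 2)%:E).
  by apply/funext => w /=; rewrite mul1r.
apply: (integral_bounded_mul (C := C ^+ 2)) => //; first exact: measurable_funX.
by move=> w; rewrite normrX lerXn2r// nnegrE// (le_trans _ (ZC w)).
Qed.

Lemma integrable_bounded_RV_mul (f : Omega -> R) (Z : {RV P >-> R}) :
  (exists C : R, forall w, `|Z w| <= C) -> P.-integrable setT (EFin \o f) ->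
  P.-integrable setT (EFin \o (fun w => f w * Z w)).
Proof. by move=> [C ZC] iF; exact: (integral_bounded_mul (C := C)). Qed.

Section noise.
Variables (s : R) (x0 : {RV P >-> 'rV[R]_n}) (eta y : R -> {RV P >-> 'rV[R]_n}).
Hypotheses (s0 : 0 < s) (signals : private_signals P s x0 eta y).

Lemma noise_coord_law i j (B : set R) : 0 <= i <= 1 -> measurable B ->
  P (coord_RV (eta i) j @^-1` B) = normal_prob 0 s B.
Proof.
by move=> i01 mB; apply: centered_gaussian_coord => //;
  exact: noise_law signals i i01.
Qed.

Lemma noise_uncorrelated i k j : 0 <= i <= 1 -> 0 <= k <= 1 -> i != k ->
  (\int[P]_w (eta i w ord0 j * eta k w ord0 j)%:E = 0)%E.
Proof.
move=> i01 k01 ik.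
have li B : measurable B -> _ := @noise_coord_law i j B i01.
have lk B : measurable B -> _ := @noise_coord_law k j B k01.
apply: (@independent_uncorrelated _ _ _ P
  (coord_RV (eta i) j) (coord_RV (eta k) j)) => //.
- move=> A B mA mB.
  have indep := noise_indep signals.
  have := indep [:: Some i; Some k] (fun o : option R =>
    if o == Some i then (fun x : 'rV[R]_n => x ord0 j) @^-1` A
    else (fun x : 'rV[R]_n => x ord0 j) @^-1` B).
  rewrite big_cons big_seq1 eqxx.
  have -> : (Some k == Some i) = false.
    by apply/eqP => -[ki]; rewrite ki eqxx in ik.
  move=> <-.
  - congr (P _); apply/seteqP; split => w /=.
      move=> [Aw Bw] o; rewrite !inE => /orP[|] /eqP ->; first by rewrite eqxx.
      by case: eqP => // -[ki]; rewrite ki eqxx in ik.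
    move=> H; split.
      by have := H (Some i); rewrite eqxx; apply; rewrite !inE eqxx.
    have := H (Some k); case: eqP => [[ki]|_]; first by rewrite ki eqxx in ik.
    by apply; rewrite !inE eqxx orbT.
  - by rewrite /= andbT inE; apply/eqP => -[ki]; rewrite ki eqxx in ik.
  - by move=> o; rewrite !inE => /orP[|] /eqP ->.
  - move=> o _; case: ifP => _;
      by apply: measurable_preimageT => //; exact: measurable_coord.
- exact: gaussian_integrable s0 _ li.
- exact: gaussian_integrable s0 _ lk.
- by apply: square_integrable_mul => //;
    [exact: gaussian_square_integrable li|exact: gaussian_square_integrable lk].
- exact: gaussian_mean s0 _ lk.
Qed.

Lemma countable_noise_correlated (Z : {RV P >-> R}) (C : R) j :
  (forall w, `|Z w| <= C) ->
  countable [set i | 0 <= i <= 1 /\ \int[P]_w (Z w * eta i w ord0 j) != 0].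
Proof.
move=> ZC.
have law i i01 B mB := @noise_coord_law i j B i01 mB.
(* Bessel's inequality asks for a positive bound on the second moments; |v| + 1 is one without
   computing the Gaussian variance. *)
pose v := fine (\int[normal_prob 0 s]_x (x ^+ 2)%:E)%E.
apply: (@countable_square_summable _ _ _
  (fun i => \int[P]_w (Z w * eta i w ord0 j))
  ((`|v| + 1) * \int[P]_w (Z w ^+ 2))) => r ur rD.
apply: (@bessel_inequality _ _ _ P _ (fun i => 0 <= i <= 1)
  (fun i w => eta i w ord0 j)) => //.
- by move=> i _; exact: (measurable_funPT (coord_RV (eta i) j)).
- by move=> i i01; exact: gaussian_square_integrable s0 _ (law i i01).
- move=> i i01; rewrite /Rintegral (gaussian_second_moment (law i i01)) -/v.
  by rewrite (le_trans (ler_norm v))// lerDl.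
- by move=> i k i01 k01 ik; rewrite /Rintegral noise_uncorrelated.
- exact: bounded_RV_square_integrable ZC.
Qed.

(** Since [m i] is [x0 + eta i], pairing it with a bounded [Z] gives the pairing of [x0] plus the
    correlation of [Z] with [eta i], which vanishes for all but countably many agents. Averaging
    over agents therefore leaves the pairing of [x0]. *)
Lemma population_integralP (m : R -> {RV P >-> 'rV[R]_n})
    (M : {RV P >-> 'rV[R]_n}) :
  integrable_vector P x0 -> truth_telling y m ->
  population_integral P m M <-> {ae P, forall w, M w = x0 w}.
Proof.
move=> ix0 truthful.
have mE i w : 0 <= i <= 1 -> m i w = x0 w + eta i w.
  by move=> i01; rewrite truthful// (signalE signals).
have ieta i j : 0 <= i <= 1 ->
  P.-integrable setT (EFin \o (fun w => eta i w ord0 j)).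
  move=> i01; apply: (gaussian_integrable s0 (U := coord_RV (eta i) j)) => B mB.
  exact: noise_coord_law.
have im i : 0 <= i <= 1 -> integrable_vector P (m i).
  move=> i01 j; have := integrableD measurableT (ix0 j) (ieta i j i01).
  by apply: eq_integrable => // w _ /=; rewrite mE// mxE.
have mean j (Z : {RV P >-> R}) : (exists C : R, forall w, `|Z w| <= C) ->
    lebesgue_measure.-integrable `[(0 : R), 1]%classic
      (EFin \o (fun i : R => \int[P]_w (m i w ord0 j * Z w))) /\
    \int[lebesgue_measure]_(i in `[0, 1]) (\int[P]_w (m i w ord0 j * Z w)) =
      \int[P]_w (x0 w ord0 j * Z w).
  move=> bZ; apply: Rintegral_countable_exceptions.
  have [C ZC] := bZ.
  apply: sub_countable (countable_noise_correlated j ZC).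
  apply: subset_card_le => i /= [i01 ne]; split => //;
    apply: contra_neq ne => e0.
  transitivity (\int[P]_w (x0 w ord0 j * Z w + Z w * eta i w ord0 j)).
    by apply: eq_Rintegral => w _; rewrite mE// mxE; ring.
  rewrite RintegralD//; first by rewrite e0 addr0.
    exact: integrable_bounded_RV_mul.
  have := integrable_bounded_RV_mul bZ (ieta i j i01).
  by apply: eq_integrable => // w _ /=; rewrite mulrC.
have mc (X : {RV P >-> 'rV[R]_n}) j :
  measurable_fun setT (EFin \o (fun w => X w ord0 j)).
  by apply/measurable_EFinP; exact: (measurable_funPT (coord_RV X j)).
split=> [[_ iM popM]|Mx0].
  have aej j : {ae P, forall w, M w ord0 j = x0 w ord0 j}.
    have : ae_eq P setT (EFin \o (fun w => M w ord0 j))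
        (EFin \o (fun w => x0 w ord0 j)).
      apply: integral_ae_eq => // B _ mB.
      have mI : measurable_fun setT (\1_B : Omega -> R).
        exact: measurable_indic.
      (* Indicators as test variables recover the integral of each coordinate of [M] over every
         event, and these determine it almost everywhere. *)
      pose Z : {RV P >-> R} := HB.pack (\1_B : Omega -> R)
        (isMeasurableFun.Build _ _ _ _ _ mI).
      have bZ : exists C : R, forall w, `|Z w| <= C.
        by exists 1 => w; rewrite /Z/= indicE; case: (_ \in _);
          rewrite ?normr1 ?normr0.
      have [_] := popM j Z bZ; rewrite (mean j Z bZ).2 /Rintegral.
      rewrite (integral_mul_indic P B (fun w => M w ord0 j)).
      rewrite (integral_mul_indic P B (fun w => x0 w ord0 j)) => e;
        have := congr1 EFin e.
      have iS f := @integrableS _ _ _ P _ _ f measurableT mB (@subsetT _ _).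
      have f1 := integrable_fin_num mB (iS _ (iM j)).
      have f2 := integrable_fin_num mB (iS _ (ix0 j)).
      by rewrite !fineK.
    by apply: filterS => w /= /(_ I) [].
  by have := ae_forall_count aej; apply: filterS => w H; apply/rowP.
have aeM j : {ae P, forall w, M w ord0 j = x0 w ord0 j}.
  by apply: filterS Mx0 => w ->.
have iM : integrable_vector P M.
  move=> j; apply/integrableP; split; first exact: mc.
  have /integrableP[_] := ix0 j; congr (_ < _)%E; apply: ae_eq_integral => //.
  - exact: measurableT_comp.
  - exact: measurableT_comp.
  - by apply: filterS (aeM j) => w /= -> _.
split => // j Z bZ; have [imean meanE] := mean j Z bZ; split => //.
rewrite meanE /Rintegral; congr fine; apply: ae_eq_integral => //.
- by apply/measurable_EFinP/measurable_funM => //;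
    exact: (measurable_funPT (coord_RV M j)).
- by apply/measurable_EFinP/measurable_funM => //;
    exact: (measurable_funPT (coord_RV x0 j)).
- by apply: filterS (aeM j) => w /= -> _.
Qed.

End noise.
End population.

(** * Macro signal and denoising loss *)

Section pi_system.
Context {R : realType} {d d' : measure_display}.
Context {Omega : measurableType d} {T : measurableType d'}.
Variables (P : probability Omega R) (X : Omega -> T).
Hypothesis mX : measurable_fun setT X.

Lemma conditionally_centered_pi_system (G : set (set T)) (D : Omega -> R) :
  @measurable _ T = <<s G >> -> setI_closed G -> G setT ->
  P.-integrable setT (EFin \o D) ->
  (forall B, G B -> (\int[P]_(w in X @^-1` B) (D w)%:E = 0)%E) ->
  conditionally_centered P X D.
Proof.
move=> GE GI GT iD cD; split => // B mB.
have mpre A : measurable A -> measurable (X @^-1` A).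
  exact: measurable_preimageT.
have iS A : measurable A -> P.-integrable (X @^-1` A) (EFin \o D).
  by move=> mA; exact: (integrableS measurableT (mpre A mA) (@subsetT _ _) iD).
apply: (dynkin_induction (P := fun A =>
  (\int[P]_(w in X @^-1` A) (D w)%:E = 0)%E) GE GI).
- exact: cD.
- exact: cD.
(* Complementation needs the total integral of [D] to vanish; [G setT] provides it. *)
- move=> A mA A0; have := cD setT GT.
  rewrite preimage_setT -(setUv (X @^-1` A)) (@integral_setU_EFin _ _ _ P)//.
  + by rewrite A0 add0r -preimage_setC.
  + exact: mpre.
  + by apply: measurableC; exact: mpre.
  + rewrite setUv; apply/measurable_EFinP; exact: measurable_int iD.
  + by apply/disj_setPCl.
- move=> F mF tF F0; rewrite preimage_bigcup.
  rewrite (@integral_bigcup _ _ _ P (fun k => X @^-1` F k) (EFin \o D))//.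
  + by apply: eseries0 => k _ _; exact: F0.
  + apply/trivIsetP => i j _ _ ij; rewrite -preimage_setI.
    by move/trivIsetP : tF => /(_ i j I I ij) ->; rewrite preimage_set0.
  + by move=> k; exact: mpre.
  + by rewrite -preimage_bigcup; apply: iS; exact: bigcupT_measurable.
- by rewrite -GE.
Qed.

End pi_system.

Section lower_box.
Context {R : realType} {n : nat}.

(* Countable pi-system generating the sigma-algebra of ['rV[R]_n]. *)
Definition lower_box (c : seq ('I_n * rat)) : set 'rV[R]_n :=
  [set x | forall p, p \in c -> x ord0 p.1 < ratr p.2].

Lemma lower_boxE c : lower_box c =
  \big[setI/setT]_(p <- c)
    ((fun x : 'rV[R]_n => x ord0 p.1) @^-1` `]-oo, ratr p.2[).
Proof.
elim: c => [|p c IH]; first by rewrite big_nil; apply/seteqP; split.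
rewrite big_cons -IH; apply/seteqP; split => x /=; rewrite ?in_itv/=.
  move=> H; split; first by apply: H; rewrite mem_head.
  by move=> q qc; apply: H; rewrite inE qc orbT.
by move=> [xp xc] q; rewrite inE => /orP[/eqP ->|/xc].
Qed.

Lemma measurable_lower_box c : measurable (lower_box c).
Proof.
rewrite lower_boxE; apply: bigsetI_measurable => p _.
by apply: measurable_preimageT => //; exact: measurable_coord.
Qed.

Lemma measurable_rVE : @measurable _ 'rV[R]_n = <<s range lower_box >>.
Proof.
apply/seteqP; split; last first.
  apply: smallest_sub; first exact: sigma_algebra_measurable.
  by move=> _ [c _ <-]; exact: measurable_lower_box.
pose T := g_sigma_algebraType (range lower_box).
have mcoord (j : 'I_n) : measurable_fun [set: T] (fun x : 'rV[R]_n => x ord0 j).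
  apply: (measurability _ (RGenInftyO.measurableE R)) => //.
  move=> _ [_ [a ->] <-]; rewrite setTI.
  (* A rational lies strictly between a coordinate of [x] and any larger real [a], so a real
     threshold is a countable union of rational ones. *)
  rewrite [X in measurable X](_ : _ = \bigcup_(r : rat)
      (if ratr r <= a then lower_box [:: (j, r)] else set0)); last first.
    apply/seteqP; split => x /=; rewrite ?in_itv/=.
      move=> /rat_in_itvoo[r]; rewrite in_itv/= => /andP[xr ra].
      exists r => //; rewrite (ltW ra) => p; rewrite inE => /eqP -> //.
    move=> [r _]; case: ifP => // ra /(_ (j, r));
      rewrite inE eqxx => /(_ isT) /=.
    by move=> xr; exact: (lt_le_trans xr).
  apply: bigcupT_measurable_rat => r; case: ifP => // _.
  by apply: sub_sigma_algebra; exists [:: (j, r)].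
apply: smallest_sub; first exact: smallest_sigma_algebra.
rewrite -bigcup_seq/= => A [j _ [B mB <-]].
exact: mcoord.
Qed.

(** Boxes intersect by concatenating their lists of constraints; a coordinate may be constrained
    several times, so no minimum of thresholds has to be taken. *)
Lemma setI_closed_lower_box : setI_closed (range lower_box).
Proof.
move=> _ _ [b _ <-] [c _ <-]; exists (b ++ c) => //.
apply/seteqP; split => x /= H.
  by split => p pc; apply: H; rewrite mem_cat pc ?orbT.
by move=> p; rewrite mem_cat => /orP[]; [exact: H.1|exact: H.2].
Qed.

Lemma lower_box_setT : range lower_box setT.
Proof. by exists [::] => //; apply/seteqP; split. Qed.

End lower_box.

(** * Estimating the state at a fixed time *)

Section diffusion.
Context {R : realType} {n : nat} {d : measure_display}.
Context {Omega : measurableType d}.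
Variables (P : probability Omega R) (x0 eps : {RV P >-> 'rV[R]_n}).
Variables (alpha sigma : R -> R).
Hypotheses (ix0 : integrable_vector P x0)
  (eps_gauss : centered_gaussian P 1 eps).

Let eps_law j (B : set R) : measurable B ->
  P (coord_RV eps j @^-1` B) = normal_prob 0 1 B.
Proof. by move=> mB; exact: centered_gaussian_coord. Qed.

Lemma gaussian_integrable_vector : integrable_vector P eps.
Proof. by move=> j; exact: (gaussian_integrable ltr01 (@eps_law j)). Qed.

Lemma gaussian_sqnorm_lty : (\int[P]_w (sqnorm (eps w))%:E < +oo)%E.
Proof.
rewrite /sqnorm; under eq_integral do rewrite -sumEFin.
rewrite ge0_integral_sum//; last by move=> j w _; rewrite lee_fin sqr_ge0.
  apply: lte_sum_pinfty => j _.
  by rewrite (gaussian_second_moment (@eps_law j)) normal_prob_second_moment.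
by move=> j; apply/measurable_EFinP/measurable_funX;
  exact: (measurable_funPT (coord_RV eps j)).
Qed.

Section fixed_time.
Variable t : R.
Let xt := noised alpha sigma x0 eps t.

Lemma measurable_noised : measurable_fun setT xt.
Proof. by apply: measurable_rVD; exact: measurable_rVZ. Qed.

Hypothesis at0 : alpha t != 0.

Lemma state_from_noised w : x0 w = (alpha t)^-1 *: (xt w - sigma t *: eps w).
Proof. by rewrite /xt /noised addrK scalerK. Qed.

(** Solving the forward equation for [x0] shows that the residual of the state is
    [- (sigma t / alpha t)] times the residual of the noise. *)
Lemma regression_reverse (e : 'rV[R]_n -> 'rV[R]_n) :
  is_regression P eps xt e ->
  is_regression P x0 xt (fun x => (alpha t)^-1 *: (x - sigma t *: e x)).
Proof.
move=> [me ce]; split.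
  apply: measurable_rVZ => //; apply: measurable_rVD => //.
  under eq_fun do rewrite -scaleNr.
  exact: measurable_rVZ.
move=> j; have -> : (fun w => x0 w ord0 j -
    ((alpha t)^-1 *: (xt w - sigma t *: e (xt w))) ord0 j) =
    (fun w => - (sigma t / alpha t) * (eps w ord0 j - e (xt w) ord0 j)).
  by apply/funext => w; rewrite state_from_noised !mxE; ring.
by apply: conditionally_centeredZ => //; exact: measurable_noised.
Qed.

(** Rescaling the signal errs by a multiple of [eps], which has a finite second moment even when
    [x0] has none. *)
Lemma finite_state_loss : exists2 g : 'rV[R]_n -> 'rV[R]_n,
  measurable_fun setT g & (square_loss P x0 xt g < +oo)%E.
Proof.
exists (fun x => (alpha t)^-1 *: x).
  exact: measurable_rVZ.
rewrite /square_loss.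
have E w : sqnorm (x0 w - (alpha t)^-1 *: xt w) =
    (sigma t / alpha t) ^+ 2 * sqnorm (eps w).
  rewrite /sqnorm mulr_sumr; apply: eq_bigr => j _.
  by rewrite state_from_noised !mxE; ring.
under eq_integral do rewrite E EFinM.
rewrite ge0_integralZl//.
- by rewrite lte_mul_pinfty ?lee_fin ?sqr_ge0// gaussian_sqnorm_lty.
- exact: measurable_sqnorm.
- by move=> w _; rewrite lee_fin sumr_ge0// => j _; exact: sqr_ge0.
- by rewrite lee_fin sqr_ge0.
Qed.

Lemma welfare_maximizing_cond_exp (phi : 'rV[R]_n -> 'rV[R]_n) :
  welfare_maximizing P x0 xt phi <-> is_cond_exp P x0 xt phi.
Proof.
have mxt := measurable_noised.
rewrite welfare_maximizingE is_cond_exp_regression//.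
have [g mg gfin] := finite_state_loss.
split; first exact: (minimizes_regression _ mxt mg gfin).
exact: regression_minimizes.
Qed.

End fixed_time.
End diffusion.

Lemma integral_probability_cst {R : realType} {d : measure_display}
    {Omega : measurableType d} (P : probability Omega R) (c : \bar R) :
  (\int[P]_w c = c)%E.
Proof.
rewrite (integral_cst P measurableT).
transitivity (c * 1)%E; last exact: mule1.
by congr (_ * _)%E; exact: probability_setT.
Qed.

(** * The denoising loss on the product with the time axis *)

Section denoiser.
Context {R : realType} {n : nat} {d : measure_display}.
Context {Omega : measurableType d}.
Variables (P : probability Omega R) (x0 eps : {RV P >-> 'rV[R]_n}).
Variables (alpha sigma : R -> R) (nu : probability R R).
Hypotheses (schedule : vp_schedule alpha sigma)
  (eps_gauss : centered_gaussian P 1 eps).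
Hypothesis nu_time : nu `[(0 : R), 1]%classic = 1%E.

Let I01 : set R := `[(0 : R), 1]%classic.

Let time_noise (z : R * Omega) : 'rV[R]_n := eps z.2.

(* The schedule is only measurable on [0, 1], hence the patching. *)
Let time_state (z : R * Omega) : 'rV[R]_n * R :=
  (noised (alpha \_ I01) (sigma \_ I01) x0 eps z.1 z.2, z.1).

Let Q : probability (R * Omega)%type R := (nu \x P)%E.

Let mI01 : measurable I01. Proof. exact: measurable_itv. Qed.

Let malpha : measurable_fun setT (alpha \_ I01).
Proof.
by apply/(measurable_restrictT _ _).1 => //; exact: alpha_measurable schedule.
Qed.

Let msigma : measurable_fun setT (sigma \_ I01).
Proof.
by apply/(measurable_restrictT _ _).1 => //; exact: sigma_measurable schedule.
Qed.

Let time_noise_measurable : measurable_fun setT time_noise.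
Proof. exact: measurableT_comp. Qed.

Let time_state_measurable : measurable_fun setT time_state.
Proof.
apply: measurable_fun_pair => //; apply: measurable_rVD; apply: measurable_rVZ.
- exact: measurableT_comp malpha _.
- exact: measurableT_comp.
- exact: measurableT_comp msigma _.
- exact: measurableT_comp.
Qed.

Let noised_patch t w : 0 <= t <= 1 ->
  noised (alpha \_ I01) (sigma \_ I01) x0 eps t w =
  noised alpha sigma x0 eps t w.
Proof.
move=> t01; rewrite /noised !patchE.
by have -> : t \in I01 by apply/mem_set; rewrite /I01/= in_itv.
Qed.

Let nu_ae : {ae nu, forall t, I01 t}.
Proof.
exists (~` I01); split => //; first exact: measurableC.
by rewrite probability_setC// [X in (1 - X)%E]nu_time subee.
Qed.

(** Tonelli on [nu \x P]. Passing from [0, 1] to the whole line and from the schedule to its patched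
    version is harmless because [nu] is carried by [0, 1]. *)
Lemma denoising_lossE (e : 'rV[R]_n -> R -> 'rV[R]_n) :
  measurable_fun setT (fun z : 'rV[R]_n * R => e z.1 z.2) ->
  denoising_loss P alpha sigma nu x0 eps e =
  square_loss Q time_noise time_state (fun z => e z.1 z.2).
Proof.
move=> me; rewrite /denoising_loss /square_loss.
have mh : measurable_fun setT (fun z : R * Omega =>
    (sqnorm (time_noise z - e (time_state z).1 (time_state z).2))%:E).
  apply: measurable_sqnorm; apply: measurable_rVD => //.
  have := measurable_rVZ (measurable_cst (-1 : R))
    (measurableT_comp me time_state_measurable).
  by under eq_fun do rewrite /= scaleN1r.
have h0 (z : R * Omega) :
    (0 <= (sqnorm (time_noise z - e (time_state z).1 (time_state z).2))%:E)%E.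
  by rewrite lee_fin sumr_ge0// => j _; exact: sqr_ge0.
rewrite (fubini_tonelli1 _ mh h0).
have mF := measurable_fun_fubini_tonelli_F (m2 := P) _ mh h0.
transitivity (\int[nu]_(t in I01) fubini_F P (fun z : R * Omega =>
    (sqnorm (time_noise z - e (time_state z).1 (time_state z).2))%:E) t)%E.
  apply: eq_integral => t /set_mem; rewrite /I01/= in_itv/= => t01.
  by apply: eq_integral => w _; rewrite /time_noise /time_state/= noised_patch.
rewrite integral_mkcond; apply: ae_eq_integral.
- exact: measurableT.
- by apply/(measurable_restrictT _ _).1; [exact: mI01|exact: measurable_funTS].
- exact: mF.
- by apply: filterS nu_ae => t It _; rewrite patchE mem_set.
Qed.

Lemma optimal_denoiserE (e : 'rV[R]_n -> R -> 'rV[R]_n) :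
  optimal_denoiser P alpha sigma nu x0 eps e <->
  minimizes_square_loss Q time_noise time_state (fun z => e z.1 z.2).
Proof.
split=> -[me opt]; (split; first exact: me).
  move=> g mg; have gE : (fun z : 'rV[R]_n * R => g (z.1, z.2)) = g.
    by apply/funext => -[].
  have := opt (fun x t => g (x, t)); rewrite gE => /(_ mg).
  by rewrite !denoising_lossE//= gE.
move=> e' me'; rewrite !denoising_lossE//.
exact: opt.
Qed.

Let time_noise_integrable : integrable_vector Q time_noise.
Proof.
move=> j; apply/(integrable12ltyP nu P).
  by apply/measurable_EFinP;
    exact: ((measurable_rVP _).1 time_noise_measurable j).
have /integrableP[_] := gaussian_integrable_vector eps_gauss j.
by rewrite /time_noise/= integral_probability_cst.
Qed.

Let zero_loss : (square_loss Q time_noise time_state (cst 0%R) < +oo)%E.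
Proof.
rewrite /square_loss.
have mh : measurable_fun setT (fun z => (sqnorm (time_noise z - 0))%:E).
  by under eq_fun do rewrite subr0; exact: measurable_sqnorm.
rewrite (fubini_tonelli1 _ mh); last first.
  by move=> z; rewrite lee_fin sumr_ge0// => j _; exact: sqr_ge0.
rewrite /fubini_F /time_noise/=;
  under eq_integral do under eq_integral do rewrite subr0.
rewrite integral_probability_cst.
exact: gaussian_sqnorm_lty.
Qed.

Lemma exists_optimal_denoiser :
  exists e, optimal_denoiser P alpha sigma nu x0 eps e.
Proof.
have [f rf] := exists_regression time_state_measurable time_noise_integrable.
exists (fun x t => f (x, t)); apply/optimal_denoiserE.
have -> : (fun z : 'rV[R]_n * R => f (z.1, z.2)) = f by apply/funext => -[].
exact: regression_minimizes.
Qed.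

(** For a fixed box [c], testing on the product of the box with a set [A] of times shows that [F c]
    integrates to 0 over every [A], so it vanishes at almost every time. Boxes being countable, one
    null set of times serves them all, and outside it the pi-system argument applies to the section
    at [t]. *)
Let sections_centered (D : R * Omega -> R) :
  conditionally_centered Q time_state D ->
  {ae nu, forall t, conditionally_centered P
    (noised (alpha \_ I01) (sigma \_ I01) x0 eps t) (fun w => D (t, w))}.
Proof.
move=> [iD cD].
pose box c (z : R * Omega) : R := \1_(lower_box c) (time_state z).1.
have mbox c : measurable_fun setT (box c).
  apply: (measurableT_comp (f := \1_(lower_box c) : 'rV[R]_n -> R)).
    by apply: measurable_indic; exact: measurable_lower_box.
  exact: measurableT_comp.
have box1 c z : `|box c z| <= 1.
  by rewrite /box indicE; case: (_ \in _); rewrite ?normr1 ?normr0.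
have ibox c : Q.-integrable setT (fun z => (D z * box c z)%:E).
  exact: (integral_bounded_mul (C := 1)).
pose F c t := (\int[P]_w (D (t, w) * box c (t, w))%:E)%E.
have iF c : nu.-integrable setT (F c).
  exact: (integrable_fubini_F (m1 := nu) (m2 := P) (ibox c)).
have F0 c : {ae nu, forall t, F c t = 0%E}.
  suff : ae_eq nu setT (F c) (cst 0%E) by apply: filterS => t /(_ I).
  apply: integral_ae_eq => // A _ mA; rewrite integral0.
  have mAX : measurable (lower_box c `*` A : set ('rV[R]_n * R)).
    by apply: measurableX => //; exact: measurable_lower_box.
  have := cD _ mAX; rewrite -(integral_mul_indic Q _ D) => D0.
  have boxE t w : D (t, w) * \1_(time_state @^-1` (lower_box c `*` A)) (t, w) =
      \1_A t * (D (t, w) * box c (t, w)).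
    rewrite /box !indicE /time_state/=.
    have -> : ((t, w) \in time_state @^-1` (lower_box c `*` A)) =
        ((time_state (t, w)).1 \in lower_box c) && (t \in A).
      by apply/idP/andP => [/set_mem[/= ? ?]|[/set_mem ? /set_mem ?]];
        [split; exact: mem_set|apply: mem_set; split].
    case: (_ \in lower_box c); case: (t \in A) => /=; ring.
  have iA : Q.-integrable setT (fun z : R * Omega =>
      (D z * \1_(time_state @^-1` (lower_box c `*` A)) z)%:E).
    apply: (integral_bounded_mul (C := 1)) => //.
      apply: measurable_indic.
      exact: (measurable_preimageT time_state_measurable mAX).
    by move=> z; rewrite indicE; case: (_ \in _); rewrite ?normr1 ?normr0.
  rewrite -D0 -(integral12_prod_meas1 iA) integral_mkcond.
  apply: eq_integral => t _; rewrite /fubini_F patchE.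
  under eq_integral do rewrite boxE.
  case: ifPn => tA; rewrite indicE.
    by rewrite tA; apply: eq_integral => w _; rewrite mul1r.
  by rewrite (negbTE tA); under eq_integral do rewrite mul0r; rewrite integral0.
have iDt : {ae nu, forall t, P.-integrable setT (fun w => (D (t, w))%:E)}.
  exact: (ae_integrable1 (m1 := nu) (m2 := P) iD).
have := ae_forall_count F0; apply: filterS2 iDt => t iDt Ft0.
apply: (conditionally_centered_pi_system _ measurable_rVE setI_closed_lower_box
  lower_box_setT) => //.
  apply: measurable_rVD; apply: measurable_rVZ => //.
move=> _ [c _ <-]; rewrite -(integral_mul_indic P _ (fun w => D (t, w))).
exact: Ft0.
Qed.

Lemma optimal_denoiser_regression (e : 'rV[R]_n -> R -> 'rV[R]_n) :
  optimal_denoiser P alpha sigma nu x0 eps e ->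
  {ae nu, forall t, 0 <= t <= 1 ->
    is_regression P eps (noised alpha sigma x0 eps t) (fun x => e x t)}.
Proof.
move=> /optimal_denoiserE mine.
have mcst0 : measurable_fun setT (cst 0%R : 'rV[R]_n * R -> 'rV[R]_n) by [].
have [me ce] := minimizes_regression time_noise_measurable time_state_measurable
  mcst0 zero_loss mine.
have := ae_forall_count (fun j => sections_centered (ce j)).
apply: filterS => t ct t01; split.
  have mp : measurable_fun setT (fun x : 'rV[R]_n => (x, t)).
    exact: measurable_fun_pair.
  exact: (measurableT_comp me mp).
move=> j; have := ct j; rewrite /time_state /time_noise/=.
have -> : noised (alpha \_ I01) (sigma \_ I01) x0 eps t =
    noised alpha sigma x0 eps t.
  by apply/funext => w; exact: noised_patch.
by [].
Qed.

End denoiser.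

(** Used to replace the state by the aggregate report inside the macro signal. *)
Lemma square_loss_ae {R : realType} {n : nat} {d d' : measure_display}
    {Omega : measurableType d} {T : measurableType d'} (P : probability Omega R)
    (Z : Omega -> 'rV[R]_n) (X X' : Omega -> T) (f : T -> 'rV[R]_n) :
  measurable_fun setT Z -> measurable_fun setT X -> measurable_fun setT X' ->
  measurable_fun setT f -> {ae P, forall w, X w = X' w} ->
  square_loss P Z X f = square_loss P Z X' f.
Proof.
move=> mZ mX mX' mf XX'.
have mloss (Y : Omega -> T) : measurable_fun setT Y ->
    measurable_fun setT (fun w => (sqnorm (Z w - f (Y w)))%:E).
  move=> mY; apply: measurable_sqnorm; apply: measurable_rVD => //.
  under eq_fun do rewrite -scaleN1r.
  by apply: measurable_rVZ => //; exact: measurableT_comp mf mY.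
apply: ae_eq_integral; [exact: measurableT|exact: mloss|exact: mloss|].
by apply: filterS XX' => w -> _.
Qed.

Section aggregate.
Context {R : realType} {n : nat} {d : measure_display}.
Context {Omega : measurableType d}.
Variables (P : probability Omega R) (x0 eps M : {RV P >-> 'rV[R]_n}).
Variables (alpha sigma : R -> R) (t : R).
Hypothesis Mx0 : {ae P, forall w, M w = x0 w}.

Lemma welfare_maximizing_aggregate (phi : 'rV[R]_n -> 'rV[R]_n) :
  welfare_maximizing P x0 (noised alpha sigma M eps t) phi <->
  welfare_maximizing P x0 (noised alpha sigma x0 eps t) phi.
Proof.
have mx := measurable_noised x0 eps alpha sigma t.
have mM := measurable_noised M eps alpha sigma t.
have lossE psi : measurable_fun setT psi ->
    square_loss P x0 (noised alpha sigma M eps t) psi =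
    square_loss P x0 (noised alpha sigma x0 eps t) psi.
  move=> mpsi; apply: square_loss_ae => //.
  by apply: filterS Mx0 => w; rewrite /noised => ->.
rewrite !welfare_maximizingE.
split=> -[mphi opt]; (split; first exact: mphi) => psi mpsi.
  by have := opt psi mpsi; rewrite !lossE.
by have := opt psi mpsi; rewrite !lossE.
Qed.

End aggregate.

(** Taking [M := x0] in the first clause shows that a population integral exists. The welfare
    clauses hold at each time with nonzero [alpha t], whereas the denoising loss does not constrain
    its minimizers on [nu]-null sets of times, hence [{ae nu, ...}]. At a given time a rule is
    determined only up to null sets of the law of [x_t], hence the inner [{ae P, ...}]. *)
Theorem proposition2 (R : realType) (n : nat) (disp : measure_display)
    (Omega : measurableType disp) (P : probability Omega R)
    (x0 eps : {RV P >-> 'rV[R]_n}) (eta y m : R -> {RV P >-> 'rV[R]_n})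
    (s : R) (alpha sigma : R -> R) (nu : probability R R)
    (s_gt0 : 0 < s)
    (x0_integrable : integrable_vector P x0)
    (signals : private_signals P s x0 eta y)
    (priors : symmetric_priors P x0 y)
    (truthful : truth_telling y m)
    (schedule : vp_schedule alpha sigma)
    (eps_gaussian : centered_gaussian P 1 eps)
    (eps_indep : mutually_independent P [set: bool]
                   (fun b => if b then x0 else eps))
    (nu_time : nu `[(0 : R), 1]%classic = 1%E) :
  [/\ forall M : {RV P >-> 'rV[R]_n},
        population_integral P m M <-> {ae P, forall w, M w = x0 w},
      forall t : R, 0 <= t <= 1 -> alpha t != 0 ->
        let xt := noised alpha sigma x0 eps t in
        [/\ exists dstar : 'rV[R]_n -> 'rV[R]_n,
              welfare_maximizing P x0 xt dstar,
            forall dstar : 'rV[R]_n -> 'rV[R]_n,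
              welfare_maximizing P x0 xt dstar <-> is_cond_exp P x0 xt dstar,
            forall (M : {RV P >-> 'rV[R]_n}) (phi : 'rV[R]_n -> 'rV[R]_n),
              population_integral P m M ->
              welfare_maximizing P x0 (noised alpha sigma M eps t) phi
                <-> is_cond_exp P x0 xt phi &
            forall dstar estar_t : 'rV[R]_n -> 'rV[R]_n,
              welfare_maximizing P x0 xt dstar ->
              is_cond_exp P eps xt estar_t ->
              {ae P, forall w,
                 dstar (xt w)
                 = (alpha t)^-1 *: (xt w - sigma t *: estar_t (xt w))}],
      exists estar : 'rV[R]_n -> R -> 'rV[R]_n,
        optimal_denoiser P alpha sigma nu x0 eps estar &
      forall estar : 'rV[R]_n -> R -> 'rV[R]_n,
        optimal_denoiser P alpha sigma nu x0 eps estar ->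
        {ae nu, forall t : R, 0 <= t <= 1 ->
          let xt := noised alpha sigma x0 eps t in
          is_cond_exp P eps xt (fun x => estar x t) /\
          (alpha t != 0 ->
           (forall M : {RV P >-> 'rV[R]_n}, population_integral P m M ->
              welfare_maximizing P x0 (noised alpha sigma M eps t)
                (reverse_estimate alpha sigma estar t)) /\
           (forall dstar : 'rV[R]_n -> 'rV[R]_n,
              welfare_maximizing P x0 xt dstar ->
              {ae P, forall w,
                 dstar (xt w)
                 = (alpha t)^-1 *: (xt w - sigma t *: estar (xt w) t)}))}].
Proof.
have popP (M : {RV P >-> 'rV[R]_n}) :
    population_integral P m M <-> {ae P, forall w, M w = x0 w}.
  exact: (population_integralP s_gt0 signals M x0_integrable truthful).
have mxt t := measurable_noised x0 eps alpha sigma t.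
have ieps := gaussian_integrable_vector eps_gaussian.
have wce t (phi : 'rV[R]_n -> 'rV[R]_n) : alpha t != 0 ->
    welfare_maximizing P x0 (noised alpha sigma x0 eps t) phi <->
    is_cond_exp P x0 (noised alpha sigma x0 eps t) phi.
  by move=> at0; exact: welfare_maximizing_cond_exp.
(* Both [dstar] and the reverse estimate are regressions of [x0] on [x_t], so uniqueness identifies
   them. This serves any version of the denoiser at a fixed time as well as the sections of a
   minimizer of the loss. *)
have denoise t (dstar e : 'rV[R]_n -> 'rV[R]_n) : alpha t != 0 ->
    welfare_maximizing P x0 (noised alpha sigma x0 eps t) dstar ->
    is_regression P eps (noised alpha sigma x0 eps t) e ->
    {ae P, forall w, dstar (noised alpha sigma x0 eps t w) = (alpha t)^-1 *:
      (noised alpha sigma x0 eps t w -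
       sigma t *: e (noised alpha sigma x0 eps t w))}.
  move=> at0 /(wce _ _ at0).
  move=> /(is_cond_exp_regression (mxt t) _ x0_integrable) rd.
  move=> /(regression_reverse at0) re.
  exact: (regression_unique (mxt t) rd re).
split.
- exact: popP.
- move=> t t01 at0 xt; split.
  + have [e /(regression_reverse at0) re] := exists_regression (mxt t) ieps.
    exists (fun x => (alpha t)^-1 *: (x - sigma t *: e x)).
    by apply/(wce _ _ at0)/is_cond_exp_regression.
  + by move=> dstar; exact: wce.
  + move=> M phi /popP Mx0.
    apply: iff_trans (wce t phi at0).
    exact: welfare_maximizing_aggregate.
  + move=> dstar e dmax /(is_cond_exp_regression (mxt t) _ ieps).
    exact: (denoise t dstar e at0 dmax).
- exact: exists_optimal_denoiser.
- move=> e /(optimal_denoiser_regression schedule eps_gaussian nu_time).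
  apply: filterS => t et t01; have re := et t01.
  split; first exact/(is_cond_exp_regression (mxt t) _ ieps).
  move=> at0; split=> [M /popP Mx0|dstar dmax].
    apply/(welfare_maximizing_aggregate _ _ _ _ Mx0).
    apply/(wce _ _ at0).
    apply/(is_cond_exp_regression (mxt t) _ x0_integrable).
    exact: regression_reverse.
  exact: (denoise t dstar _ at0 dmax re).
Qed.
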